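(* Let $X$ be a separable Hilbert space with norm $\|\cdot\|_X$, and let $\mu_0=\mathcal N(0,\mathcal C)$ be a centred Gaussian measure on $X$ with $\mu_0(X)=1$, where $\mathcal C$ is a positive-definite, self-adjoint, trace-class covariance operator. Let $\Phi:X\to\mathbb R$ satisfy: (1) there exist $p>0$, $K>0$ such that $0\le\Phi(u)\le K(1+\|u\|_X^p)$ for all $u\in X$; (2) for every $r>0$ there is $K(r)>0$ such that $|\Phi(u)-\Phi(v)|\le K(r)\|u-v\|_X$ for all $u,v\in X$ with $\max\{\|u\|_X,\|v\|_X\}<r$. Let $\mu$ be a measure on $X$ equivalent to $\mu_0$ with $\frac{d\mu}{d\mu_0}(u)\propto\exp(-\Phi(u))$. For $\delta>0$ consider the two proposals, with $w\sim\mathcal N(0,\mathcal C)$ independent of $u$: (pCN) $(2+\delta)v=(2-\delta)u+\sqrt{8\delta}\,w$; (CN) $(2\mathcal C+\delta I)v=(2\mathcal C-\delta I)u+\sqrt{8\delta\mathcal C}\,w$. Let $\eta$ denote the joint law of $(u,v)$ with $u\sim\mu$ and $v$ drawn from the proposal given $u$, and let the acceptance probability be $a(u,v)=\min\{1,\exp(\Phi(u)-\Phi(v))\}$. Then both the pCN and CN Metropolis–Hastings algorithms with fixed $\delta$ are defined on $X$ (that is, the law $\eta^\perp$ of $(v,u)$ is equivalent to $\eta$, with $\frac{d\eta^\perp}{d\eta}(u,v)=\exp(\Phi(u)-\Phi(v))$), and furthermore, for each of the two proposals, $$\lim_{\delta\to0}\mathbb E^{\eta}\,a(u,v)=1.$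$
   Context: The Metropolis–Hastings algorithm with proposal kernel $q$ and target $\mu$ accepts a proposed move $u\to v$ with probability $\min\{1,\frac{d\eta^\perp}{d\eta}(u,v)\}$, where $\eta(du,dv)=q(u,dv)\mu(du)$ and $\eta^\perp(du,dv)=q(v,du)\mu(dv)$; it is ''defined on $X$'' when $\eta^\perp$ and $\eta$ are equivalent so this Radon–Nikodym derivative exists. *)

(* Defs.v *)
From HB Require Import structures.
From mathcomp Require Import all_boot all_order all_algebra.
From mathcomp Require Import all_classical all_reals all_analysis.
Set Implicit Arguments. Unset Strict Implicit. Unset Printing Implicit Defensive.
Import Order.TTheory GRing.Theory Num.Theory.
Import numFieldNormedType.Exports.
Local Open Scope classical_set_scope.
Local Open Scope ring_scope.

Section Defs.
Context {R : realType}.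

Definition hilbert_inner (X : normedModType R) (ip : X -> X -> R) : Prop :=
  [/\ (forall x y, ip x y = ip y x),
      (forall (a : R) x y z, ip (a *: x + y) z = a * ip x z + ip y z) &
      (forall x, ip x x = `|x| ^+ 2)].

Definition separable_hilbert (X : completeNormedModType R) (ip : X -> X -> R) :=
  hilbert_inner ip /\ exists f : nat -> X, dense (range f).

Definition bounded_linear (X : normedModType R) (T : X -> X) : Prop :=
  (forall (a : R) x y, T (a *: x + y) = a *: T x + T y) /\
  exists M : R, forall x, `|T x| <= M * `|x|.

Definition self_adjoint (X : normedModType R) (ip : X -> X -> R) (T : X -> X) :=
  forall x y, ip (T x) y = ip x (T y).

Definition positive_definite (X : normedModType R) (ip : X -> X -> R) (T : X -> X) :=
  forall x, x != 0 -> 0 < ip (T x) x.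

Definition nonnegative_op (X : normedModType R) (ip : X -> X -> R) (T : X -> X) :=
  forall x, 0 <= ip (T x) x.

Definition orthonormal_family (X : normedModType R) (ip : X -> X -> R) n
    (e : 'I_n -> X) :=
  forall i j, ip (e i) (e j) = (i == j)%:R.

(** Trace class (for a nonnegative self-adjoint operator): the trace
    sup over finite orthonormal families of sum <T e_i, e_i> is finite. *)
Definition trace_class (X : normedModType R) (ip : X -> X -> R) (T : X -> X) :=
  exists M : R, forall n (e : 'I_n -> X), orthonormal_family ip e ->
    \sum_(i < n) ip (T (e i)) (e i) <= M.

Definition borel (X : normedModType R) := g_sigma_algebraType (@open X).

(** mu0 = N(0, C): characteristic functional E exp(i<h,x>) = exp(-<Ch,h>/2). *)
Definition centred_gaussian (X : normedModType R) (ip : X -> X -> R)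
    (C : X -> X) (mu0 : probability (borel X) R) :=
  forall h : X,
    (\int[mu0]_x (cos (ip h x))%:E = (expR (- (ip (C h) h / 2)))%:E)%E /\
    (\int[mu0]_x (sin (ip h x))%:E = 0)%E.

Definition pCN_proposal (X : normedModType R) (delta : R) (u w : X) : X :=
  ((2 - delta) / (2 + delta)) *: u + (Num.sqrt (8 * delta) / (2 + delta)) *: w.

(** CN proposal: the v with (2C + delta I) v = (2C - delta I) u + sqrt(8 delta) C^{1/2} w,
    where S = C^{1/2}. *)
Definition CN_proposal (X : normedModType R) (C S : X -> X) (delta : R) (u w : X) : X :=
  xget 0 [set v | 2 *: C v + delta *: v
                  = 2 *: C u - delta *: u + Num.sqrt (8 * delta) *: S w].

Definition eta_law (X : normedModType R) (mu mu0 : probability (borel X) R)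
    (prop : X -> X -> X) : set (borel X * borel X) -> \bar R :=
  pushforward (mu \x mu0)%E (fun p : borel X * borel X => ((p.1, prop p.1 p.2) : borel X * borel X)).

Definition eta_perp (X : normedModType R) (mu mu0 : probability (borel X) R)
    (prop : X -> X -> X) : set (borel X * borel X) -> \bar R :=
  pushforward (eta_law mu mu0 prop) (fun p : borel X * borel X => ((p.2, p.1) : borel X * borel X)).

Definition MH_defined (X : normedModType R) (mu mu0 : probability (borel X) R)
    (prop : X -> X -> X) (Phi : X -> R) : Prop :=
  (forall A : set (borel X * borel X), measurable A ->
     eta_perp mu mu0 prop A =
     (\int[eta_law mu mu0 prop]_(z in A) (expR (Phi z.1 - Phi z.2))%:E)%E) /\
  (forall A : set (borel X * borel X), measurable A ->
     eta_perp mu mu0 prop A = 0%E -> eta_law mu mu0 prop A = 0%E).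

Definition mean_acceptance (X : normedModType R) (mu mu0 : probability (borel X) R)
    (prop : X -> X -> X) (Phi : X -> R) : \bar R :=
  (\int[eta_law mu mu0 prop]_z (Num.min 1 (expR (Phi z.1 - Phi z.2)))%:E)%E.

End Defs.

(* Main.v *)
(* Both proposals have the form v = A u + B w, where A and B are self-adjoint,
   commute with each other and with C^{1/2}, and satisfy A^2 + B^2 = I.  Hence
   (u, w) |-> (A u + B w, B u - A w) is an involution whose first component is v,
   and it preserves mu0 x mu0 because it preserves the characteristic functional.
   Under mu0 the pair (u, v) is therefore exchangeable, and weighting by
   exp (- Phi u) yields the density exp (Phi u - Phi v).

   A probability on X x X is determined by its characteristic functional: the
   bounded pointwise limits of trigonometric polynomials form an algebra, and the
   sets whose indicator belongs to it form a sigma-algebra which contains the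
   half-spaces, since 1_{g > a} is recovered from sgn (sin (t (g - a))) as t -> 0.

   For the limit, v -> u pointwise as delta -> 0; for CN this amounts to
   delta (2C + delta)^-1 x -> 0, true because C is injective.  Continuity of Phi
   and dominated convergence conclude. *)
Require Import Defs.
From HB Require Import structures.
From mathcomp Require Import all_boot all_order all_algebra.
From mathcomp Require Import all_classical all_reals all_analysis.
From mathcomp Require Import measurable_realfun.
From mathcomp Require Import ring lra.
Set Implicit Arguments. Unset Strict Implicit. Unset Printing Implicit Defensive.
Import Order.TTheory GRing.Theory Num.Theory.
Import numFieldNormedType.Exports.
Local Open Scope classical_set_scope.
Local Open Scope ring_scope.

(** * Uniqueness of characteristic functionals *)

(** Products are deliberately not a constructor: every generator is compatible with integration
    (linearity, dominated convergence), so equality of integrals follows by induction, and stability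
    under products is proved separately in [trig_mul]. *)
Inductive trig_closure (T : Type) (R : realType) (L : set (T -> R)) :
    (T -> R) -> Prop :=
| trig_cos g : L g -> trig_closure L (fun x => cos (g x))
| trig_sin g : L g -> trig_closure L (fun x => sin (g x))
| trig_lin a f h : trig_closure L f -> trig_closure L h ->
    trig_closure L (fun x => a * f x + h x)
| trig_lim (F : nat -> T -> R) f M : (forall n, trig_closure L (F n)) ->
    (forall n x, `|F n x| <= M) ->
    (forall x, F n x @[n --> \oo] --> f x) -> trig_closure L f.

Section TrigClosure.
Context (T : Type) (R : realType) (L : set (T -> R)).
Hypothesis L0 : L (fun=> 0).
Hypothesis Llin : forall a g h, L g -> L h -> L (fun x => a * g x + h x).
Local Notation tc := (trig_closure L).

Lemma trig_ext f h : f =1 h -> tc f -> tc h.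
Proof. by move=> /funext ->. Qed.

Lemma trig_bounded f : tc f -> exists M : R, forall x, `|f x| <= M.
Proof.
elim=> [g _|g _|a u v _ [M uM] _ [N vN]|F h M _ _ FM Fh].
- by exists 1 => x; rewrite ler_norml cos_geN1 cos_le1.
- by exists 1 => x; rewrite ler_norml sin_geN1 sin_le1.
- exists (`|a| * M + N) => x; apply: le_trans (ler_normD _ _) _.
  by rewrite normrM lerD// ler_wpM2l.
- exists M => x.
  have cn : `|F n x| @[n --> \oo] --> `|h x| by apply: cvg_norm; exact: Fh.
  rewrite -(cvg_lim _ cn)//; apply: limr_le; first exact: cvgP cn.
  by apply: nearW => n; exact: FM.
Qed.

Lemma trig_cst c : tc (fun=> c).
Proof.
have c1 := trig_cos L0.
have c0 := trig_lin (-1) c1 c1.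
by apply: trig_ext (trig_lin c c1 c0) => x /=; rewrite cos0; ring.
Qed.

Lemma trig_scale c f : tc f -> tc (fun x => c * f x).
Proof.
by move=> /(trig_lin c) /(_ (trig_cst 0)); apply: trig_ext => x /=; ring.
Qed.

Lemma trig_add f h : tc f -> tc h -> tc (fun x => f x + h x).
Proof.
by move=> /(trig_lin 1) tf /tf; apply: trig_ext => x /=; ring.
Qed.

Lemma trig_sub f h : tc f -> tc h -> tc (fun x => f x - h x).
Proof.
by move=> tf /(trig_lin (-1)) /(_ tf); apply: trig_ext => x /=; ring.
Qed.

(** The product-to-sum formulas settle the generators, since [L] contains [k + g] and [g - k]; the
    other cases only use that multiplication by a bounded function respects linear combinations and
    bounded limits. *)
Lemma trig_mul_base g f : L g -> tc f ->
  tc (fun x => cos (g x) * f x) /\ tc (fun x => sin (g x) * f x).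
Proof.
move=> Lg; elim=> [k Lk|k Lk|a u v _ [cu su] _ [cv sv]|F h M _ IH FM Fh].
- have Lp := Llin 1 Lg Lk; have Lm := Llin (-1) Lk Lg.
  split.
    apply: trig_ext (trig_scale (2^-1) (trig_add (trig_cos Lp) (trig_cos Lm))).
    move=> x /=; rewrite mul1r mulN1r (addrC (- k x)) cosD cosB.
    by field.
  apply: trig_ext (trig_scale (2^-1) (trig_add (trig_sin Lp) (trig_sin Lm))).
  move=> x /=; rewrite mul1r mulN1r (addrC (- k x)) sinD sinB.
  by field.
- have Lp := Llin 1 Lg Lk; have Lm := Llin (-1) Lk Lg.
  split.
    apply: trig_ext (trig_scale (2^-1) (trig_sub (trig_sin Lp) (trig_sin Lm))).
    move=> x /=; rewrite mul1r mulN1r (addrC (- k x)) sinD sinB.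
    by field.
  apply: trig_ext (trig_scale (2^-1) (trig_sub (trig_cos Lm) (trig_cos Lp))).
  move=> x /=; rewrite mul1r mulN1r (addrC (- k x)) cosB cosD.
  by field.
- split.
    by apply: trig_ext (trig_lin a cu cv) => x /=; ring.
  by apply: trig_ext (trig_lin a su sv) => x /=; ring.
- split.
    apply: (trig_lim (fun n => (IH n).1) (M := M)) => [n x|x].
      rewrite normrM -[leRHS]mul1r ler_pM//.
      by rewrite ler_norml cos_geN1 cos_le1.
    by apply: cvgMr; exact: Fh.
  apply: (trig_lim (fun n => (IH n).2) (M := M)) => [n x|x].
    rewrite normrM -[leRHS]mul1r ler_pM//.
    by rewrite ler_norml sin_geN1 sin_le1.
  by apply: cvgMr; exact: Fh.
Qed.

Lemma trig_mul f h : tc f -> tc h -> tc (fun x => f x * h x).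
Proof.
move=> tf th; elim: tf => [g Lg|g Lg|a u v _ tu _ tv|F k M _ IH FM Fk].
- by have [] := trig_mul_base Lg th.
- by have [] := trig_mul_base Lg th.
- by apply: trig_ext (trig_lin a tu tv) => x /=; ring.
- have [N hN] := trig_bounded th.
  apply: (trig_lim IH (M := M * N)) => [n x|x].
    by rewrite normrM ler_pM.
  by apply: cvgMl; exact: Fk.
Qed.

(** An odd cubic fixing -1, 0 and 1, with 0 repelling (slope 3/2): its iterates on [-1, 1] tend to
    the sign function, and being polynomials they preserve the trigonometric algebra. *)
Definition smoothstep (y : R) : R := (3 * y - y ^+ 3) / 2.

(** The gap to 1 is multiplied at each step by [(1 - z) * (2 + z) / 2 = 1 - z / 2 - z ^+ 2 / 2],
    which is at most [1 - y / 2] because the iterates increase from [y]. *)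
Lemma smoothstep_iter_pos y n : 0 < y <= 1 ->
  y <= iter n smoothstep y <= 1 /\ 1 - iter n smoothstep y <= (1 - y / 2) ^+ n.
Proof.
move=> /andP[y0 y1]; elim: n => [|n [/andP[h1 h2] h3]].
  by rewrite /= lexx y1 expr0; split=> //; lra.
rewrite iterS exprS; set z := iter n smoothstep y in h1 h2 h3 *.
have z0 : 0 < z by exact: lt_le_trans h1.
have zz : z * z <= 1 by nra.
have q1 : 1 - smoothstep z = (1 - z) * ((1 - z) * (2 + z) / 2).
  by rewrite /smoothstep; field.
have q2 : smoothstep z - z = z * (1 - z * z) / 2.
  by rewrite /smoothstep; field.
have p1 : 0 <= (1 - z) * (2 + z) / 2 by rewrite divr_ge0// mulr_ge0//; lra.
have p2 : 0 <= z * (1 - z * z) / 2 by rewrite divr_ge0// mulr_ge0//; lra.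
split.
  apply/andP; split; first by lra.
  by rewrite -subr_ge0 q1 mulr_ge0// subr_ge0.
rewrite q1 [leRHS]mulrC ler_pM//; first by lra.
by nra.
Qed.

Lemma smoothstep_cvg y : `|y| <= 1 ->
  iter n smoothstep y @[n --> \oo] --> Num.sg y.
Proof.
have pos z : 0 < z <= 1 -> iter n smoothstep z @[n --> \oo] --> (1 : R).
  move=> z01; have /andP[z0 z1] := z01.
  apply: (@squeeze_cvgr _ _ _ _ (fun n => 1 - (1 - z / 2) ^+ n) (fun=> 1)).
  - apply: nearW => n; have [/andP[_ ->] h] := smoothstep_iter_pos n z01.
    by rewrite andbT; lra.
  - rewrite -[X in _ --> X]subr0; apply: cvgB; first exact: cvg_cst.
    have := @cvg_geometric R 1 (1 - z / 2); rewrite /geometric/=.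
    under eq_fun do rewrite mul1r.
    by apply; rewrite ger0_norm; lra.
  - exact: cvg_cst.
have odd z n : iter n smoothstep (- z) = - iter n smoothstep z.
  elim: n => [//|n IH]; by rewrite !iterS IH /smoothstep; field.
rewrite ler_norml => /andP[yl yu].
case: (ltrgt0P y) => [y0|y0|->].
- by rewrite gtr0_sg//; apply: pos; rewrite y0.
- rewrite ltr0_sg// -[y]opprK.
  under eq_fun do rewrite odd.
  by apply: cvgN; apply: pos; lra.
- rewrite sgr0; under eq_fun => n.
    rewrite (_ : iter n smoothstep 0 = 0); last first.
      elim: n => [//|n IH]; by rewrite iterS IH /smoothstep expr0n/=; field.
    over.
  exact: cvg_cst.
Qed.

Lemma trig_sg f : tc f -> (forall x, `|f x| <= 1) -> tc (fun x => Num.sg (f x)).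
Proof.
move=> tf f1; apply: (@trig_lim _ _ _ (fun n x => iter n smoothstep (f x)) _ 1).
- elim=> [//|n IH].
  have t3 := trig_mul IH (trig_mul IH IH).
  apply: trig_ext (trig_lin (3 / 2) IH (trig_scale (- 2^-1) t3)) => x /=.
  by rewrite /smoothstep; field.
- move=> n x; have := f1 x.
  elim: n => [//|n IH] /IH; rewrite iterS /smoothstep.
  move: (iter n _ _) => z; rewrite !ler_norml => /andP[z1 z2].
  (* These are twice [1 - smoothstep z] and, below, twice [1 + smoothstep z]: the interval [-1, 1]
     is mapped into itself. *)
  have a1 : 0 <= (1 - z) * (1 - z) * (2 + z) by rewrite !mulr_ge0//; lra.
  have a2 : 0 <= (1 + z) * (1 + z) * (2 - z) by rewrite !mulr_ge0//; lra.
  have -> : z ^+ 3 = z * z * z by ring.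
  by apply/andP; split; lra.
- by move=> x; exact: smoothstep_cvg.
Qed.

(** The sequence is eventually constant: once [|u| / (n + 1)] is below pi, the sine has the sign of
    [u]. *)
Lemma sg_sin_cvg (u : R) : Num.sg (sin (n.+1%:R^-1 * u)) @[n --> \oo] --> Num.sg u.
Proof.
have pos (z : R) : 0 < z -> \forall n \near \oo, Num.sg (sin (n.+1%:R^-1 * z)) = 1.
  move=> z0.
  have : n.+1%:R^-1 * z @[n --> \oo] --> 0.
    by rewrite -(mul0r z); apply: cvgMl; exact: cvg_harmonic.
  move=> /(cvgr_lt 0) /(_ _ (pi_gt0 R)); apply: filterS => n npi.
  by rewrite gtr0_sg// sin_gt0_pi// npi andbT mulr_gt0// invr_gt0.
case: (ltrgt0P u) => [u0|u0|->].
- rewrite gtr0_sg//; apply: cvg_near_cst; exact: pos.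
- rewrite ltr0_sg//; apply: cvg_near_cst.
  have := pos (- u); rewrite oppr_gt0 => /(_ u0); apply: filterS => n.
  rewrite mulrN sinN sgrN => h.
  by rewrite -[LHS]opprK h.
- rewrite sgr0; apply: cvg_near_cst; apply: nearW => n.
  by rewrite mulr0 sin0 sgr0.
Qed.

Lemma trig_halfspace g a : L g -> tc (\1_[set x | a < g x]).
Proof.
move=> Lg.
have Ls t : L (fun x => t * g x).
  by have := Llin t Lg L0; congr L; apply/funext => x; rewrite addr0.
(* Constants need not belong to [L], so [a] is moved into the coefficients by the subtraction
   formula for the sine. *)
have ts t : tc (fun x => sin (t * (g x - a))).
  apply: trig_ext (trig_sub (trig_scale (cos (t * a)) (trig_sin (Ls t)))
    (trig_scale (sin (t * a)) (trig_cos (Ls t)))) => x /=.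
  by rewrite mulrBr sinB; ring.
have sg1 (y : R) : `|Num.sg y| <= 1 by rewrite normr_sg lern1 leq_b1.
have tsg : tc (fun x => Num.sg (g x - a)).
  apply: (@trig_lim _ _ _ (fun n x => Num.sg (sin (n.+1%:R^-1 * (g x - a)))) _ 1).
  - move=> n; apply: trig_sg => // x.
    by rewrite ler_norml sin_geN1 sin_le1.
  - by move=> n x; exact: sg1.
  - by move=> x; exact: sg_sin_cvg.
(* With [s] the sign of [g x - a], [(s ^+ 2 + s) / 2] is 1 when [s = 1] and 0 when [s] is 0 or
   -1. *)
apply: trig_ext (trig_scale (2^-1) (trig_add (trig_mul tsg tsg) tsg)) => x /=.
rewrite indicE; case: (ltrgt0P (g x - a)) => h.
- rewrite gtr0_sg// mem_set//=; first by field.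
  by rewrite -subr_gt0.
- rewrite ltr0_sg// memNset//=; first by field.
  by move: h; rewrite subr_lt0 => /lt_gtF /negbT/negP.
- rewrite h sgr0 memNset//=; first by field.
  by move/eqP : h; rewrite subr_eq0 => /eqP ->; rewrite ltxx.
Qed.

(** Complements come from [1 - \1_A], finite unions from products through De Morgan, and countable
    unions as bounded pointwise limits of the finite ones. *)
Lemma trig_sigma_algebra : sigma_algebra setT [set A : set T | tc (\1_A)].
Proof.
have setC1 (A : set T) x : \1_(~` A) x = 1 - \1_A x :> R.
  rewrite !indicE; have [xA|xA] := boolP (x \in A).
    by rewrite memNset ?subrr// => /(_ (set_mem xA)).
  by rewrite mem_set ?subr0// => /mem_set; exact/negP.
have setCtc A : tc (\1_A) -> tc (\1_(~` A)).
  move=> tA; apply: trig_ext (trig_sub (trig_cst 1) tA) => x /=.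
  by rewrite setC1.
split => /=.
- by rewrite indic0; exact: trig_cst.
- by move=> A tA; rewrite setTD; exact: setCtc.
- move=> F tF.
  apply: (@trig_lim _ _ _ (fun n => \1_(\big[setU/set0]_(i < n) F i)) _ 1).
  + elim=> [|n IH]; first by rewrite big_ord0 indic0; exact: trig_cst.
    rewrite big_ord_recr/= -[_ `|` _]setCK setCU; apply: (setCtc).
    by rewrite indicI; exact: trig_mul (setCtc _ IH) (setCtc _ (tF n)).
  + by move=> n x; rewrite indicE normr_nat lern1 leq_b1.
  + move=> x; have [[k _ Fx]|nFx] := pselect ((\bigcup_k F k) x).
      apply: cvg_near_cst; exists k.+1 => // n /= kn.
      rewrite !indicE !mem_set//; first by exists k.
      by rewrite -bigcup_mkord; exists k.
    apply: cvg_near_cst; apply: nearW => n.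
    rewrite !indicE !memNset//; rewrite -bigcup_mkord => -[k _ Fx].
    by apply: nFx; exists k.
Qed.

End TrigClosure.

(** * Integration of functions in the trigonometric closure *)

Lemma trig_measurable d (T : measurableType d) (R : realType) (L : set (T -> R))
    f : (forall g, L g -> measurable_fun setT g) ->
  trig_closure L f -> measurable_fun setT f.
Proof.
move=> mL; elim=> [g Lg|g Lg|a u v _ mu _ mv|F h M _ mF _ Fh].
- apply: (measurableT_comp _ (mL _ Lg)).
  by apply: continuous_measurable_fun; exact: continuous_cos.
- apply: (measurableT_comp _ (mL _ Lg)).
  by apply: continuous_measurable_fun; exact: continuous_sin.
- by apply: measurable_funD => //; apply: measurable_funM.
- by apply: measurable_realfun.measurable_fun_cvg mF _ => x _; exact: Fh.
Qed.

Lemma bounded_integrable d (T : measurableType d) (R : realType)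
    (P : probability T R) (f : T -> R) M : measurable_fun setT f ->
  (forall x, `|f x| <= M) -> P.-integrable setT (EFin \o f).
Proof.
move=> mf fM; apply: measurable_bounded_integrable => //.
  by rewrite -ge0_fin_numE ?fin_num_measure.
exists M; split; first exact: num_real.
by move=> N MN x _ /=; exact: le_trans (fM x) (ltW MN).
Qed.

Lemma bounded_cvg_integral d (T : measurableType d) (R : realType)
    (P : probability T R) (F : nat -> T -> R) (f : T -> R) M :
  (forall n, measurable_fun setT (F n)) -> (forall n x, `|F n x| <= M) ->
  (forall x, F n x @[n --> \oo] --> f x) ->
  (\int[P]_x (F n x)%:E @[n --> \oo] --> \int[P]_x (f x)%:E)%E.
Proof.
move=> mF FM Ff.
apply: (@dominated_cvg _ _ _ P setT measurableT (fun n x => (F n x)%:E)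
  (fun x => (f x)%:E) (cst M%:E)).
- by move=> n; exact/measurable_EFinP.
- by move=> x _; apply: cvg_EFin; [exact: nearW | exact: Ff].
- by [].
- apply: (@bounded_integrable _ _ _ _ (cst M) `|M|) => //.
- by move=> n x _ /=; rewrite lee_fin.
Qed.

Lemma trig_integral_unique d (T : measurableType d) (R : realType)
    (L : set (T -> R)) (P Q : probability T R) f :
  (forall g, L g -> measurable_fun setT g) ->
  (forall g, L g -> \int[P]_x (cos (g x))%:E = \int[Q]_x (cos (g x))%:E)%E ->
  (forall g, L g -> \int[P]_x (sin (g x))%:E = \int[Q]_x (sin (g x))%:E)%E ->
  trig_closure L f -> (\int[P]_x (f x)%:E = \int[Q]_x (f x)%:E)%E.
Proof.
move=> mL ecos esin.
have int (U : probability T R) k : trig_closure L k ->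
    U.-integrable setT (EFin \o k).
  move=> tk; have [M kM] := trig_bounded tk.
  by apply: bounded_integrable kM; exact: trig_measurable tk.
elim=> [g Lg|g Lg|a u v tu eu tv ev|F h M tF eF FM Fh].
- exact: ecos.
- exact: esin.
- have lin (U : probability T R) : (\int[U]_x (a * u x + v x)%:E =
      a%:E * \int[U]_x (u x)%:E + \int[U]_x (v x)%:E)%E.
    under eq_integral do rewrite EFinD EFinM.
    have iu := int U u tu; have iv := int U v tv.
    rewrite integralD//; last exact: integrableZl.
    by rewrite integralZl.
  by rewrite !lin eu ev.
- have mF n : measurable_fun setT (F n) by exact: trig_measurable (tF n).
  have cP := @bounded_cvg_integral _ _ _ P F h M mF FM Fh.
  have cQ := @bounded_cvg_integral _ _ _ Q F h M mF FM Fh.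
  rewrite -(cvg_lim _ cP)// -(cvg_lim _ cQ)//.
  by under eq_fun do rewrite eF.
Qed.

Lemma trig_measure_unique d (T : measurableType d) (R : realType)
    (L : set (T -> R)) (P Q : probability T R) A :
  (forall g, L g -> measurable_fun setT g) ->
  (forall g, L g -> \int[P]_x (cos (g x))%:E = \int[Q]_x (cos (g x))%:E)%E ->
  (forall g, L g -> \int[P]_x (sin (g x))%:E = \int[Q]_x (sin (g x))%:E)%E ->
  measurable A -> trig_closure L (\1_A) -> P A = Q A.
Proof.
move=> mL ecos esin mA /(trig_integral_unique mL ecos esin).
by rewrite !integral_indic// !setIT.
Qed.

(** * Inner products and linear operators *)

Section HilbertAlgebra.
Context (R : realType) (X : normedModType R) (ip : X -> X -> R).
Hypothesis ipH : hilbert_inner ip.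

Lemma ipC x y : ip x y = ip y x. Proof. by case: ipH. Qed.
Lemma ipxx x : ip x x = `|x| ^+ 2. Proof. by case: ipH. Qed.
Lemma ipDl x y z : ip (x + y) z = ip x z + ip y z.
Proof. by case: ipH => _ /(_ 1 x y z) h _; rewrite scale1r mul1r in h. Qed.
Lemma ip0l z : ip 0 z = 0.
Proof. by have := ipDl 0 0 z; rewrite addr0 => /eqP; rewrite -subr_eq0 opprD addrA subrr sub0r oppr_eq0 => /eqP. Qed.
Lemma ipZl a x z : ip (a *: x) z = a * ip x z.
Proof. by case: ipH => _ /(_ a x 0 z); rewrite addr0 ip0l addr0. Qed.
Lemma ipNl x z : ip (- x) z = - ip x z.
Proof. by rewrite -scaleN1r ipZl mulN1r. Qed.
Lemma ipBl x y z : ip (x - y) z = ip x z - ip y z.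
Proof. by rewrite ipDl ipNl. Qed.
Lemma ip0r z : ip z 0 = 0. Proof. by rewrite ipC ip0l. Qed.
Lemma ipDr x y z : ip z (x + y) = ip z x + ip z y.
Proof. by rewrite ipC ipDl !(ipC z). Qed.
Lemma ipZr a x z : ip z (a *: x) = a * ip z x.
Proof. by rewrite ipC ipZl (ipC z). Qed.
Lemma ipNr x z : ip z (- x) = - ip z x.
Proof. by rewrite ipC ipNl (ipC z). Qed.
Lemma ipBr x y z : ip z (x - y) = ip z x - ip z y.
Proof. by rewrite ipDr ipNr. Qed.

Lemma ip_ge0 x : 0 <= ip x x.
Proof. by rewrite ipxx exprn_ge0. Qed.

(** Cauchy-Schwarz: the squared norm of [|y| *: x - |x| *: y] equals
    [2 |x| |y| (|x| |y| - ip x y)]. *)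
Lemma ip_le_norm x y : ip x y <= `|x| * `|y|.
Proof.
have [->|x0] := eqVneq x 0; first by rewrite ip0l normr0 mul0r.
have [->|y0] := eqVneq y 0; first by rewrite ip0r normr0 mulr0.
have px : 0 < `|x| by rewrite normr_gt0.
have py : 0 < `|y| by rewrite normr_gt0.
have := ip_ge0 (`|y| *: x - `|x| *: y).
rewrite ipBl !ipBr !ipZl !ipZr (ipC y x) !ipxx => h.
have {h} : 0 <= 2 * (`|x| * `|y|) * (`|x| * `|y| - ip x y).
  by apply: le_trans h _; rewrite le_eqVlt; apply/orP; left; apply/eqP; ring.
by rewrite pmulr_rge0 ?subr_ge0// mulr_gt0// mulr_gt0.
Qed.

Lemma norm_ip_le x y : `|ip x y| <= `|x| * `|y|.
Proof.
rewrite ler_norml ip_le_norm andbT.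
by have := ip_le_norm (- x) y; rewrite ipNl normrN lerNl.
Qed.

Lemma ip_continuous h : continuous (fun x => ip h x).
Proof.
move=> x; apply/(@cvgrPdist_lt _ R^o) => /= e e0.
have he : 0 < `|h| + 1 by rewrite ltr_wpDl.
have := @cvgr_dist_lt _ _ _ _ (nbhs_filter x) id x cvg_id (e / (`|h| + 1)).
move=> /(_ (divr_gt0 e0 he)); apply: filterS => y xy.
rewrite -ipBr; apply: le_lt_trans (norm_ip_le _ _) _.
apply: le_lt_trans (_ : (`|h| + 1) * `|x - y| < _).
  by rewrite ler_wpM2r// lerDl.
by rewrite mulrC -ltr_pdivlMr.
Qed.

Lemma ip_inj x y : (forall h, ip h x = ip h y) -> x = y.
Proof.
move=> hxy; apply/eqP; rewrite -subr_eq0 -normr_eq0 -sqrf_eq0 -ipxx.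
by rewrite ipBr hxy subrr.
Qed.

Lemma bounded_linear_bound (T : X -> X) : bounded_linear T ->
  exists2 M : R, 0 < M & forall x, `|T x| <= M * `|x|.
Proof.
move=> [_ [M hM]]; exists (`|M| + 1); first by rewrite ltr_wpDl.
move=> x; apply: le_trans (hM x) _; rewrite ler_wpM2r//.
by rewrite (le_trans (ler_norm _))// lerDl.
Qed.

End HilbertAlgebra.

(** Pairing both sides with an arbitrary vector turns a linear identity between vectors into a
    scalar one that [ring] can decide. *)
Ltac vector_ring ipH := apply: (ip_inj ipH) => ?;
  rewrite ?(ipDr ipH, ipNr ipH, ipZr ipH, ip0r ipH); ring.

Section LinearOperators.
Context (R : realType) (X : normedModType R) (T : X -> X).
Hypothesis linT : forall (a : R) x y, T (a *: x + y) = a *: T x + T y.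

Lemma linopD x y : T (x + y) = T x + T y.
Proof. by have := linT 1 x y; rewrite !scale1r. Qed.
Lemma linop0 : T 0 = 0.
Proof. by apply: (addrI (T 0)); rewrite -linopD !addr0. Qed.
Lemma linopZ a x : T (a *: x) = a *: T x.
Proof. by have := linT a x 0; rewrite linop0 !addr0. Qed.
Lemma linopN x : T (- x) = - T x.
Proof. by rewrite -scaleN1r linopZ scaleN1r. Qed.
Lemma linopB x y : T (x - y) = T x - T y.
Proof. by rewrite linopD linopN. Qed.

Lemma linop_cvg (M : R) (u : nat -> X) x : (forall y, `|T y| <= M * `|y|) ->
  u n @[n --> \oo] --> x -> T (u n) @[n --> \oo] --> T x.
Proof.
move=> hM /cvgrPdist_lt ux; apply/cvgrPdist_lt => e e0.
have M0 : 0 < `|M| + 1 by rewrite ltr_wpDl.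
have := ux (e / (`|M| + 1)) (divr_gt0 e0 M0); apply: filterS => n xn.
rewrite -linopB; apply: le_lt_trans (hM _) _.
apply: le_lt_trans (_ : (`|M| + 1) * `|x - u n| < _).
  by rewrite ler_wpM2r// (le_trans (ler_norm _))// lerDl.
by rewrite mulrC -ltr_pdivlMr.
Qed.

End LinearOperators.

(** Lax-Milgram by Banach's fixed point theorem: for small [t], the map sending [x] to
    [x - t *: (T x - y)] is a contraction, and its fixed point solves the equation. *)
Lemma coercive_surjective (R : realType) (X : completeNormedModType R)
    (ip : X -> X -> R) (T : X -> X) (c : R) :
  hilbert_inner ip -> bounded_linear T -> 0 < c ->
  (forall x, c * `|x| ^+ 2 <= ip (T x) x) -> forall y, exists x, T x = y.
Proof.
move=> ipH bT c0 coer y.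
have [linT _] := bT; have [M0 M0gt hM0] := bounded_linear_bound bT.
(* Adding [c] to the operator bound forces [c < M], so that [q2] below lies in [0, 1). *)
pose M := M0 + c; have Mgt : 0 < M by rewrite addr_gt0.
have hM x : `|T x| <= M * `|x|.
  by apply: le_trans (hM0 x) _; rewrite ler_wpM2r// lerDl ltW.
have cM : c < M by rewrite /M ltrDr.
(* The squared contraction factor is at most [1 - 2 t c + t ^+ 2 * M ^+ 2]; this [t] minimizes it,
   with minimum [q2]. *)
pose t := c / M ^+ 2; pose q2 := 1 - (c / M) ^+ 2.
have cM1 : c / M < 1 by rewrite ltr_pdivrMr ?mul1r.
have cM0 : 0 < c / M by rewrite divr_gt0.
have q20 : 0 <= q2 by rewrite /q2 subr_ge0 expr_le1// ltW.
have q21 : q2 < 1 by rewrite /q2 ltrBlDr ltrDl exprn_gt0.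
pose f x := x - t *: (T x - y).
have t0 : 0 < t by rewrite divr_gt0// exprn_gt0.
have fc x : `|x - t *: T x| <= Num.sqrt q2 * `|x|.
  rewrite -(@ler_pXn2r _ 2)// ?nnegrE ?mulr_ge0 ?sqrtr_ge0//.
  rewrite exprMn sqr_sqrtr// -(ipxx ipH).
  rewrite (ipBl ipH) !(ipBr ipH) !(ipZl ipH) !(ipZr ipH) (ipC ipH x (T x)) !(ipxx ipH).
  have h1 := coer x.
  have h2 : `|T x| ^+ 2 <= M ^+ 2 * `|x| ^+ 2.
    by rewrite -exprMn ler_pXn2r// ?nnegrE// mulr_ge0// ltW.
  have h3 : t * (c * `|x| ^+ 2) <= t * ip (T x) x by rewrite ler_wpM2l// ltW.
  have h4 : t * t * `|T x| ^+ 2 <= t * t * (M ^+ 2 * `|x| ^+ 2).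
    by rewrite ler_wpM2l// mulr_ge0// ltW.
  have h5 : t * t * (M ^+ 2 * `|x| ^+ 2) = t * (c * `|x| ^+ 2).
    by rewrite /t; field; rewrite gt_eqF.
  have h6 : q2 * `|x| ^+ 2 = `|x| ^+ 2 - t * (c * `|x| ^+ 2).
    by rewrite /q2 /t; field; rewrite gt_eqF.
  rewrite h6; lra.
have fT : set_fun [set: X] [set: X] f by [].
pose F : {fun [set: X] >-> [set: X]} := HB.pack f (isFun.Build X X setT setT f fT).
have ctr : is_contraction F.
  exists (NngNum (sqrtr_ge0 q2)); split => /=.
    by rewrite -sqrtr1 ltr_sqrt.
  move=> [x1 x2] _ /=.
  rewrite (_ : F x1 - F x2 = (x1 - x2) - t *: T (x1 - x2)); first exact: fc.
  by rewrite /F/= /f (linopB linT); vector_ring ipH.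
have [x _ /esym xE] := banach_fixed_point ctr closedT (ex_intro _ (0 : X) I).
exists x; have : t *: (T x - y) = 0.
  by move: xE; rewrite /F/= /f => /(congr1 (fun z => x - z)); rewrite opprB addrCA subrr addr0.
by move=> /eqP; rewrite scaler_eq0 gt_eqF//= subr_eq0 => /eqP.
Qed.

(** * The Borel sigma-algebra of a separable Hilbert space *)

Lemma sigma_algebra_bigcap T (G : set (set T)) (F : nat -> set T) :
  sigma_algebra setT G -> (forall n, G (F n)) -> G (\bigcap_n F n).
Proof.
move=> [_ GC GU] GF; rewrite -[\bigcap_n F n]setCK -setTD; apply: (GC).
by rewrite setC_bigcap; apply: GU => n; rewrite -setTD; exact: GC.
Qed.

Lemma sigma_algebra_preimage T U (G : set (set T)) (f : T -> U) :
  sigma_algebra setT G -> sigma_algebra setT [set A | G (f @^-1` A)].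
Proof.
move=> [G0 GC GU]; split => /=.
- by rewrite preimage_set0.
- by move=> A GA; rewrite setTD -preimage_setC -setTD; exact: GC.
- by move=> F GF; rewrite preimage_bigcup; exact: GU.
Qed.

Section BorelHilbert.
Context (R : realType) (X : normedModType R) (ip : X -> X -> R).
Hypothesis ipH : hilbert_inner ip.
Variable q : nat -> X.
Hypothesis q_dense : dense (range q).

Lemma dense_approx z (e : R) : 0 < e -> exists j, `|z - q j| < e.
Proof.
move=> e0; have [|x [zx [j _ jx]]] := @q_dense (ball z e) _ (ball_open z e).
  by exists z; exact: ballxx.
by exists j; rewrite jx; move: zx; rewrite -ball_normE.
Qed.

(** Countably many tests suffice: as [q j] approaches [z], the hypothesis tends to
    [|z| ^+ 2 <= r * |z|]. Closed balls thereby become countable intersections of half-spaces. *)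
Lemma norm_le_dual z (r : R) : 0 <= r ->
  (forall j, ip (q j) z <= r * `|q j|) -> `|z| <= r.
Proof.
move=> r0 hz; have [->|z0] := eqVneq z 0; first by rewrite normr0.
have pz : 0 < `|z| by rewrite normr_gt0.
rewrite -(ler_pM2r pz) -expr2; apply/ler_addgt0Pr => e e0.
(* Replacing [z] by [q j] costs [|z - q j| * |z|] on the left and [r * |z - q j|] on the right,
   hence the accuracy [e / (|z| + r)]. *)
have k0 : 0 < `|z| + r by rewrite ltr_wpDr.
have [j zj] := dense_approx z (divr_gt0 e0 k0).
rewrite -(ipxx ipH) -[X in ip X _](subrK (q j)) (ipDl ipH).
have h1 := ip_le_norm ipH (z - q j) z.
have h2 : `|q j| <= `|z| + `|z - q j|.
  by rewrite -[X in `|X| <= _](subKr z) (le_trans (ler_normB _ _)).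
have h3 : r * `|q j| <= r * (`|z| + `|z - q j|) by rewrite ler_wpM2l.
have h4 : `|z - q j| * (`|z| + r) < e by rewrite -ltr_pdivlMr.
have := hz j; lra.
Qed.

(** By separability an open set is the countable union of those closed balls [K i n], with dense
    centres and radii [1 / (n + 1)], that it contains. *)
Lemma open_sub_halfspaces (G : set (set X)) : sigma_algebra setT G ->
  (forall h a, G [set x | a < ip h x]) -> open `<=` G.
Proof.
move=> sG Gh U oU; have [G0 GC GU] := sG.
pose K i n := [set x | `|x - q i| <= n.+1%:R^-1].
have GK i n : G (K i n).
  have -> : K i n = \bigcap_j
      (setT `\` [set x | n.+1%:R^-1 * `|q j| + ip (q j) (q i) < ip (q j) x]).
    apply/seteqP; split => [x /= Kx j _|x hx].
      split=> //; apply/negP; rewrite -leNgt -lerBlDr -(ipBr ipH).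
      by rewrite (le_trans (ip_le_norm ipH _ _))// mulrC ler_wpM2r.
    apply: norm_le_dual => // j; have [_ /= /negP] := hx j I.
    by rewrite -leNgt (ipBr ipH) lerBlDr.
  by apply: sigma_algebra_bigcap => // j; apply: GC.
(* The inclusion is put inside the set, so that the unions run over all indices and a ball not
   contained in [U] contributes the empty set. *)
have -> : U = \bigcup_i \bigcup_n [set x | K i n `<=` U /\ K i n x].
  apply/seteqP; split => [x Ux|x [i _ [n _ [KU /KU]]]]//.
  have [e /= e0 xe] := (nbhs_ballP _ _).1 (open_nbhs_nbhs (conj oU Ux)).
  (* Half of [e], because a point of the ball reaches [x] through the centre [q i], at the cost of
     two radii. *)
  have [n ne] : exists n, n.+1%:R^-1 < e / 2.
    have /(cvgr_lt 0) := @cvg_harmonic R; move=> /(_ (e / 2)).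
    by rewrite divr_gt0// => /(_ isT)[N _ /(_ N (leqnn N)) /= hN]; exists N.
  have n0 : 0 < n.+1%:R^-1 :> R by rewrite invr_gt0.
  have [i xi] := dense_approx x n0.
  exists i => //; exists n => //; split; last exact: ltW.
  move=> y Ky; apply: xe; rewrite -ball_normE/=.
  rewrite -(subrKA (q i)) (le_lt_trans (ler_normD _ _))// distrC (distrC _ y).
  rewrite distrC in xi.
  by rewrite [ltRHS]splitr ltr_leD ?(lt_trans xi)// (le_trans Ky)// ltW.
apply: (GU) => i; apply: (GU) => n; have [KU|nKU] := pselect (K i n `<=` U).
  by rewrite (_ : [set _ | _] = K i n)//; apply/seteqP; split => x //= [].
by rewrite (_ : [set _ | _] = set0)//; apply/seteqP; split => x //= [].
Qed.

Lemma borel_sub_halfspaces (G : set (set X)) : sigma_algebra setT G ->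
  (forall h a, G [set x | a < ip h x]) ->
  forall A : set (borel X), measurable A -> G A.
Proof.
move=> sG Gh A; apply: smallest_sub => //.
exact: open_sub_halfspaces.
Qed.

(** The Pettis principle: in a separable space weak measurability implies Borel measurability, since
    half-spaces generate the open sets. *)
Lemma measurable_borel d (T : measurableType d) (f : T -> borel X) :
  (forall h, measurable_fun setT (fun t => ip h (f t))) -> measurable_fun setT f.
Proof.
move=> mf; apply: (@measurability _ _ T (borel X) setT f (@open X) erefl) => _ [A oA <-].
rewrite setTI.
apply: (open_sub_halfspaces (sigma_algebra_preimage f (sigma_algebra_measurable T))) => //.
move=> h a /=.
rewrite (_ : _ @^-1` _ = setT `&` (fun t => ip h (f t)) @^-1` `]a, +oo[%classic).
  by apply: mf => //; exact: measurable_itv.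
by apply/seteqP; split => t /=; rewrite in_itv/= andbT => //; case.
Qed.

Lemma continuous_measurable_borel (g : X -> R) : continuous g ->
  measurable_fun setT (g : borel X -> R).
Proof.
move=> cg; apply: (measurability _ (RGenOpens.measurableE R)).
move=> _ [_ [a [b ->]] <-]; rewrite setTI; apply: sub_sigma_algebra.
have oab := @interval_open R (BRight a) (BLeft b) isT isT.
by apply: open_comp => // x _; exact: cg.
Qed.

Lemma measurable_ip h : measurable_fun setT (ip h : borel X -> R).
Proof. by apply: continuous_measurable_borel; exact: ip_continuous. Qed.

(** The functionals [ip h u + ip k w] on the product: with this choice of [L], the cosine and sine
    integrals are the characteristic functional of a measure on pairs. *)
Definition phases : set (borel X * borel X -> R) :=
  [set g | exists h k, g = fun p => ip h p.1 + ip k p.2].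

Lemma phases0 : phases (fun=> 0).
Proof. by exists 0, 0; apply/funext => p; rewrite !(ip0l ipH) addr0. Qed.

Lemma phases_linear a g g' : phases g -> phases g' ->
  phases (fun x => a * g x + g' x).
Proof.
move=> [h [k ->]] [h' [k' ->]]; exists (a *: h + h'), (a *: k + k').
by apply/funext => p; rewrite !(ipDl ipH) !(ipZl ipH); ring.
Qed.

Lemma measurable_phases g : phases g -> measurable_fun setT g.
Proof.
move=> [h [k ->]]; apply: measurable_funD.
  exact: (measurableT_comp (measurable_ip h) measurable_fst).
exact: (measurableT_comp (measurable_ip k) measurable_snd).
Qed.

(** Rectangles generate the product sigma-algebra, and the indicator of a rectangle is a product of
    two indicators, each reduced to half-spaces through a projection. *)
Lemma measurable_trig_closure (A : set (borel X * borel X)) :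
  measurable A -> trig_closure phases (\1_A : _ -> R).
Proof.
have sT := trig_sigma_algebra phases0 phases_linear.
rewrite measurable_prod_measurableType.
move: A; apply: (smallest_sub sT) => _ [A1 mA1 [A2 mA2 <-]].
rewrite /= (_ : A1 `*` A2 = fst @^-1` A1 `&` snd @^-1` A2)//.
rewrite indicI; apply: trig_mul; [exact: phases0|exact: phases_linear| |].
  apply: (borel_sub_halfspaces (sigma_algebra_preimage fst sT)) mA1 => h a.
  apply: (trig_halfspace phases0 phases_linear) => //.
  by exists h, 0; apply/funext => p; rewrite (ip0l ipH) addr0.
apply: (borel_sub_halfspaces (sigma_algebra_preimage snd sT)) mA2 => h a.
apply: (trig_halfspace phases0 phases_linear) => //.
by exists 0, h; apply/funext => p; rewrite (ip0l ipH) add0r.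
Qed.

Lemma pair_measure_unique (P Q : probability (borel X * borel X)%type R) A :
  (forall h k, \int[P]_p (cos (ip h p.1 + ip k p.2))%:E =
               \int[Q]_p (cos (ip h p.1 + ip k p.2))%:E)%E ->
  (forall h k, \int[P]_p (sin (ip h p.1 + ip k p.2))%:E =
               \int[Q]_p (sin (ip h p.1 + ip k p.2))%:E)%E ->
  measurable A -> P A = Q A.
Proof.
move=> ecos esin mA.
apply: (trig_measure_unique measurable_phases _ _ mA (measurable_trig_closure mA)).
  by move=> g [h [k ->]]; exact: ecos.
by move=> g [h [k ->]]; exact: esin.
Qed.

End BorelHilbert.

(** * The Crank-Nicolson operators *)

Section Resolvent.
Context (R : realType) (X : completeNormedModType R) (ip : X -> X -> R).
Variables (C S : X -> X).
Hypothesis ipH : hilbert_inner ip.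
Hypotheses (bC : bounded_linear C) (saC : self_adjoint ip C).
Hypothesis pdC : positive_definite ip C.
Hypotheses (bS : bounded_linear S) (saS : self_adjoint ip S).
Hypothesis SS : forall x, S (S x) = C x.

Let linC := bC.1.
Let linS := bS.1.

Lemma positive_definite_ge0 x : 0 <= ip (C x) x.
Proof.
by have [->|/pdC/ltW//] := eqVneq x 0; rewrite (ip0r ipH).
Qed.

Definition shifted delta x := 2 *: C x + delta *: x.

Lemma shifted_linear delta a x y :
  shifted delta (a *: x + y) = a *: shifted delta x + shifted delta y.
Proof. by rewrite /shifted linC; vector_ring ipH. Qed.

Lemma shifted_bounded_linear delta : bounded_linear (shifted delta).
Proof.
split; first exact: shifted_linear.
have [M M0 hM] := bounded_linear_bound bC.
exists (2 * M + `|delta|) => x; apply: le_trans (ler_normD _ _) _.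
by rewrite !normrZ mulrDl lerD// -mulrA normr_nat ler_wpM2l.
Qed.

Lemma shifted_coercive delta x : delta * `|x| ^+ 2 <= ip (shifted delta x) x.
Proof.
rewrite /shifted (ipDl ipH) !(ipZl ipH) (ipxx ipH) lerDr mulr_ge0//.
exact: positive_definite_ge0.
Qed.

(** The inverse of [2C + delta I] for positive [delta]. Using the same [xget 0] as [CN_proposal]
    makes the two agree by unfolding, and by [shiftedK] the default value does not interfere. *)
Definition resolvent delta y := xget 0 [set x | shifted delta x = y].

Section FixedDelta.
Variable delta : R.
Hypothesis delta0 : 0 < delta.

Lemma shifted_inj : injective (shifted delta).
Proof.
move=> x y xy; apply/eqP; rewrite -subr_eq0 -normr_eq0 -sqrf_eq0.
have := shifted_coercive delta (x - y).
rewrite (linopB (shifted_linear delta)) xy subrr (ip0l ipH).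
by rewrite pmulr_rle0// => h; rewrite eq_le h exprn_ge0.
Qed.

Lemma shiftedK y : shifted delta (resolvent delta y) = y.
Proof.
have [x xy] := coercive_surjective ipH (shifted_bounded_linear delta) delta0
  (shifted_coercive delta) y.
by rewrite /resolvent; apply: (@xgetPex _ 0 [set x | shifted delta x = y]); exists x.
Qed.

Lemma resolventK x : resolvent delta (shifted delta x) = x.
Proof. by apply: shifted_inj; rewrite shiftedK. Qed.

Lemma resolvent_linear a x y : resolvent delta (a *: x + y) = a *: resolvent delta x + resolvent delta y.
Proof. by apply: shifted_inj; rewrite shifted_linear !shiftedK. Qed.

Lemma resolvent_sa : self_adjoint ip (resolvent delta).
Proof.
move=> x y; rewrite -{2}(shiftedK x) -{1}(shiftedK y) /shifted.
by rewrite !(ipDl ipH, ipDr ipH, ipZl ipH, ipZr ipH) saC.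
Qed.

Lemma sqrt_comm x : S (C x) = C (S x). Proof. by rewrite -!SS. Qed.

Lemma shifted_S x : shifted delta (S x) = S (shifted delta x).
Proof. by rewrite /shifted (linopD linS) !(linopZ linS) sqrt_comm. Qed.

Lemma shifted_C x : shifted delta (C x) = C (shifted delta x).
Proof. by rewrite /shifted (linopD linC) !(linopZ linC). Qed.

Lemma resolvent_S x : resolvent delta (S x) = S (resolvent delta x).
Proof. by apply: shifted_inj; rewrite shiftedK shifted_S shiftedK. Qed.

Lemma resolvent_C x : resolvent delta (C x) = C (resolvent delta x).
Proof. by apply: shifted_inj; rewrite shiftedK shifted_C shiftedK. Qed.

End FixedDelta.

Lemma resolvent_shifted delta gamma x : 0 < delta -> 0 < gamma ->
  resolvent gamma (shifted delta x) = shifted delta (resolvent gamma x).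
Proof.
move=> d0 g0; rewrite /shifted (linopD (resolvent_linear g0)) !(linopZ (resolvent_linear g0)).
by rewrite (resolvent_C g0).
Qed.

(** Since [shifted (- delta)] is [2C - delta I], this is the Cayley-type operator
    [(2C + delta I)^-1 (2C - delta I)]. *)
Definition CN_drift delta u := resolvent delta (shifted (- delta) u).
Definition CN_noise delta w := resolvent delta (Num.sqrt (8 * delta) *: S w).

Lemma CN_proposalE delta u w : 0 < delta ->
  CN_proposal C S delta u w = CN_drift delta u + CN_noise delta w.
Proof.
move=> d0; rewrite -(linopD (resolvent_linear d0)) /shifted scaleNr.
by rewrite /CN_proposal /resolvent /shifted.
Qed.

(** * Algebra of the Crank-Nicolson drift and noise *)

Section Reflection.
Variable delta : R.
Hypothesis delta0 : 0 < delta.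
Local Notation A := (CN_drift delta).
Local Notation B := (CN_noise delta).
Local Notation s := (Num.sqrt (8 * delta)).

Lemma CN_noiseE w : B w = s *: S (resolvent delta w).
Proof. by rewrite /CN_noise (linopZ (resolvent_linear delta0)) (resolvent_S delta0). Qed.

(** Writing [2C - delta I] as [(2C + delta I) - 2 delta I] makes the drift affine in the resolvent,
    so symmetry, commutation and the limit in [delta] are all inherited from it. *)
Lemma CN_driftE u : A u = u - (2 * delta) *: resolvent delta u.
Proof.
rewrite /CN_drift (_ : shifted _ u = shifted delta u - (2 * delta) *: u).
  rewrite (linopB (resolvent_linear delta0)) (resolventK delta0).
  by rewrite (linopZ (resolvent_linear delta0)).
by rewrite /shifted; vector_ring ipH.
Qed.

Lemma CN_drift_linear a x y : A (a *: x + y) = a *: A x + A y.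
Proof. by rewrite !CN_driftE (resolvent_linear delta0); vector_ring ipH. Qed.

Lemma CN_noise_linear a x y : B (a *: x + y) = a *: B x + B y.
Proof. by rewrite !CN_noiseE (resolvent_linear delta0) linS; vector_ring ipH. Qed.

Lemma CN_drift_sa : self_adjoint ip A.
Proof.
move=> x y; rewrite !CN_driftE (ipBl ipH) (ipBr ipH) (ipZl ipH) (ipZr ipH).
by rewrite (resolvent_sa delta0).
Qed.

Lemma CN_noise_sa : self_adjoint ip B.
Proof.
move=> x y; rewrite !CN_noiseE (ipZl ipH) (ipZr ipH).
by rewrite -(resolvent_S delta0) (resolvent_sa delta0) saS.
Qed.

Lemma CN_drift_S x : A (S x) = S (A x).
Proof. by rewrite !CN_driftE (linopB linS) (linopZ linS) (resolvent_S delta0). Qed.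

Lemma CN_noise_S x : B (S x) = S (B x).
Proof. by rewrite !CN_noiseE (linopZ linS) (resolvent_S delta0). Qed.

Lemma CN_drift_noise x : A (B x) = B (A x).
Proof.
rewrite CN_driftE !CN_noiseE CN_driftE.
rewrite (linopB (resolvent_linear delta0)) !(linopZ (resolvent_linear delta0)).
rewrite (linopB linS) !(linopZ linS) (resolvent_S delta0).
by vector_ring ipH.
Qed.

(** This is the identity [(2C - delta I)^2 + 8 delta C = (2C + delta I)^2]. *)
Lemma CN_square x : A (A x) + B (B x) = x.
Proof.
have lr := resolvent_linear delta0.
(* Everything is expressed through [z], which clears the inverses and leaves an identity between
   polynomials in [C]. *)
set z := resolvent delta (resolvent delta x).
have xE : x = shifted delta (shifted delta z) by rewrite !(shiftedK delta0).
have rx : resolvent delta x = shifted delta z by rewrite (shiftedK delta0).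
have -> : B (B x) = (8 * delta) *: C z.
  rewrite !CN_noiseE (linopZ lr) (linopZ linS) (resolvent_S delta0) SS scalerA.
  by rewrite -expr2 sqr_sqrtr// mulr_ge0// ltW.
rewrite (CN_driftE (A x)) CN_driftE (linopB lr) (linopZ lr) -/z rx xE.
rewrite /shifted (linopD linC) !(linopZ linC).
by vector_ring ipH.
Qed.

(** With [r] the resolvent of [w], the left side is [8 delta <C r, r>], and [2 C r = w - delta r]
    turns it into [4 <w - delta r, delta r>]. The noise thus vanishes with [delta r]. *)
Lemma CN_noise_norm w :
  `|B w| ^+ 2 <= 4 * (`|w| * `|delta *: resolvent delta w|).
Proof.
rewrite CN_noiseE -(ipxx ipH) (ipZl ipH) (ipZr ipH) -saS SS mulrA.
rewrite -expr2 sqr_sqrtr; last by rewrite mulr_ge0// ltW.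
set r := resolvent delta w.
have wE : w = 2 *: C r + delta *: r by rewrite -/(shifted delta r) (shiftedK delta0).
have -> : 8 * delta * ip (C r) r =
    4 * (ip w (delta *: r) - `|delta *: r| ^+ 2).
  rewrite -(ipxx ipH) {1}wE.
  by rewrite !(ipDl ipH, ipDr ipH, ipZl ipH, ipZr ipH); ring.
rewrite ler_wpM2l// (le_trans _ (ip_le_norm ipH _ _))//.
by rewrite gerBl exprn_ge0.
Qed.

End Reflection.

(* As delta decreases to 0, [damp delta] decreases to the orthogonal projection
   on ker C, which is 0; this monotonicity gives the Cauchy property without
   diagonalizing C. *)
Definition damp delta x := delta *: resolvent delta x.

(** For [r] the resolvent of [x], [x - damp delta x] is [2 C r], whose inner product with [delta r]
    is nonnegative. *)
Lemma damp_norm delta x : 0 < delta ->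
  `|damp delta x| ^+ 2 <= ip (damp delta x) x.
Proof.
move=> d0; rewrite /damp; set r := resolvent delta x.
have xE : x = 2 *: C r + delta *: r by rewrite -/(shifted delta r) (shiftedK d0).
rewrite -(ipxx ipH) -subr_ge0 -(ipBr ipH) [X in ip _ (X - _)]xE addrK.
rewrite (ipZl ipH) (ipZr ipH) (ipC ipH) mulr_ge0 ?(ltW d0)// mulr_ge0//.
exact: positive_definite_ge0.
Qed.

(** The difference [D] of the two damped vectors satisfies [<D, x - D> >= 0]: with [z] the double
    resolvent of [x], both [D] and [x - D] are polynomials in [C] with nonnegative coefficients
    applied to [z]. *)
Lemma damp_diff delta gamma x : 0 < gamma -> gamma <= delta ->
  `|damp delta x - damp gamma x| ^+ 2 <=
  ip (damp delta x) x - ip (damp gamma x) x.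
Proof.
move=> g0 gd; have d0 : 0 < delta by exact: lt_le_trans gd.
rewrite -(ipBl ipH) -(ipxx ipH) -subr_ge0 -(ipBr ipH).
set z := resolvent gamma (resolvent delta x).
have xE : x = shifted gamma (shifted delta z).
  by rewrite /z -resolvent_shifted// (shiftedK d0) (shiftedK g0).
have rd : resolvent delta x = shifted gamma z by rewrite (shiftedK g0).
have rg : resolvent gamma x = shifted delta z.
  by rewrite /z -resolvent_shifted// (shiftedK d0).
have dE : damp delta x - damp gamma x = (2 * (delta - gamma)) *: C z.
  by rewrite /damp rd rg /shifted; vector_ring ipH.
have -> : x - (damp delta x - damp gamma x) =
    4 *: C (C z) + (4 * gamma) *: C z + (gamma * delta) *: z.
  rewrite dE {1}xE /shifted (linopD linC) !(linopZ linC).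
  by vector_ring ipH.
rewrite dE !(ipDr ipH) !(ipZr ipH) !(ipZl ipH).
rewrite !addr_ge0// !mulr_ge0// ?subr_ge0 ?(ltW g0) ?(ltW d0)//.
- by rewrite (ipC ipH) positive_definite_ge0.
- exact: ip_ge0 ipH _.
- exact: positive_definite_ge0.
Qed.

(** The numbers [a n] decrease and are bounded below, so [damp_diff] makes the vectors a Cauchy
    sequence. Their limit is annihilated by [C], hence is 0. *)
Lemma damp_seq_cvg x : damp n.+1%:R^-1 x @[n --> \oo] --> 0.
Proof.
have d0 n : 0 < n.+1%:R^-1 :> R by rewrite invr_gt0.
pose a n := ip (damp n.+1%:R^-1 x) x.
have le_inv n m : (n <= m)%N -> m.+1%:R^-1 <= n.+1%:R^-1 :> R.
  by move=> nm; rewrite lef_pV2 ?posrE// ler_nat ltnS.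
have a_dec : {homo a : n m / (n <= m)%N >-> m <= n}.
  move=> n m nm; rewrite -subr_ge0; apply: le_trans (damp_diff x (d0 m) (le_inv _ _ nm)).
  exact: exprn_ge0.
have a_ge0 n : 0 <= a n.
  by apply: le_trans (damp_norm x (d0 n)); exact: exprn_ge0.
have lba : has_lbound (range a) by exists 0 => _ [n _ <-].
have acvg := nonincreasing_cvgn a_dec lba.
have inf_le n : inf (range a) <= a n by apply: ge_inf => //; exists n.
have : cvg (damp n.+1%:R^-1 x @[n --> \oo]).
  apply: cauchy_cvg; apply: cauchy_exP => e e0.
  have := @cvgr_dist_lt _ _ _ _ _ _ _ acvg (e ^+ 2) (exprn_gt0 2 e0).
  move=> [N _ hN]; exists (damp N.+1%:R^-1 x); exists N => // n /= Nn.
  rewrite -ball_normE/=.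
  rewrite -(@ltr_pXn2r _ 2)// ?nnegrE ?(ltW e0)//.
  apply: le_lt_trans (damp_diff x (d0 n) (le_inv _ _ Nn)) _.
  have := hN N (leqnn N); rewrite /= distrC ger0_norm ?subr_ge0//.
  by apply: le_lt_trans; rewrite lerB// ; exact: inf_le n.
move=> /cvg_ex[z zcvg].
suff z0 : C z = 0.
  have [zz|/pdC] := eqVneq z 0; first by rewrite -zz.
  by rewrite z0 (ip0l ipH) ltxx.
have [M M0 hM] := bounded_linear_bound bC.
have c1 := linop_cvg linC hM zcvg.
(* The resolvent equation gives [C (damp delta x) = (delta / 2) *: (x - damp delta x)], a null
   scalar times a convergent vector. *)
have c2 : C (damp n.+1%:R^-1 x) @[n --> \oo] --> 0.
  have -> : (fun n => C (damp n.+1%:R^-1 x)) =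
      (fun n => (n.+1%:R^-1 / 2) *: (x - damp n.+1%:R^-1 x)).
    apply/funext => n; rewrite /damp (linopZ linC).
    set r := resolvent _ x.
    have xE : x = 2 *: C r + n.+1%:R^-1 *: r.
      by rewrite -/(shifted _ r) (shiftedK (d0 n)).
    rewrite [X in _ *: (X - _)]xE addrK scalerA; congr (_ *: _); field.
    by rewrite nat1r pnatr_eq0.
  rewrite -(scale0r (x - z)); apply: cvgZ; last first.
    by apply: cvgB => //; exact: cvg_cst.
  by rewrite -(mul0r (2^-1)); apply: cvgMl; exact: cvg_harmonic.
exact: (cvg_unique _ c1 c2).
Qed.

Lemma damp_cvg x : damp delta x @[delta --> 0^'+] --> 0.
Proof.
apply/cvgr0Pnorm_lt => e e0.
(* Monotonicity passes from the sequence to every small [delta]: [|damp delta x| ^+ 2] is at most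
   [|damp (1 / (N + 1)) x| * |x|]. The added 1 keeps the divisor positive when [x = 0]. *)
have := damp_seq_cvg x => /cvgr0Pnorm_lt /(_ (e ^+ 2 / (`|x| + 1))).
have x1 : 0 < `|x| + 1 by rewrite ltr_wpDl.
rewrite divr_gt0 ?exprn_gt0// => /(_ isT)[N _ /(_ N (leqnn N)) /= hN].
have N0 : 0 < N.+1%:R^-1 :> R by rewrite invr_gt0.
near=> delta.
have d0 : 0 < delta by near: delta; exact: nbhs_right_gt.
have dN : delta <= N.+1%:R^-1 by near: delta; exact: nbhs_right_le.
rewrite -(@ltr_pXn2r _ 2)// ?nnegrE ?(ltW e0)//.
apply: le_lt_trans (damp_norm x d0) _.
have h : ip (damp delta x) x <= ip (damp N.+1%:R^-1 x) x.
  rewrite -subr_ge0; apply: le_trans (damp_diff x d0 dN); exact: exprn_ge0.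
apply: le_lt_trans h _; apply: le_lt_trans (ip_le_norm ipH _ _) _.
apply: le_lt_trans (_ : `|damp N.+1%:R^-1 x| * (`|x| + 1) < _).
  by rewrite ler_wpM2l// lerDl.
by rewrite -ltr_pdivlMr.
Unshelve. all: by end_near. Qed.

Lemma CN_cvg u w : CN_proposal C S delta u w @[delta --> 0^'+] --> u.
Proof.
have c1 : u - 2 *: damp delta u @[delta --> 0^'+] --> u.
  rewrite -[X in _ --> X]subr0; apply: cvgB; first exact: cvg_cst.
  rewrite -(scaler0 X (2 : R)); apply: cvgZ; first exact: cvg_cst.
  exact: damp_cvg.
have c2 : CN_noise delta w @[delta --> 0^'+] --> 0.
  apply/cvgr0Pnorm_lt => e e0.
  have w1 : 0 < 4 * (`|w| + 1) by rewrite mulr_gt0// ltr_wpDl.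
  have := damp_cvg w => /cvgr0Pnorm_lt /(_ (e ^+ 2 / (4 * (`|w| + 1)))).
  rewrite divr_gt0 ?exprn_gt0// => /(_ isT) h.
  near=> delta.
  have d0 : 0 < delta by near: delta; exact: nbhs_right_gt.
  rewrite -(@ltr_pXn2r _ 2)// ?nnegrE ?(ltW e0)//.
  apply: le_lt_trans (CN_noise_norm d0 w) _.
  have : `|damp delta w| < e ^+ 2 / (4 * (`|w| + 1)) by near: delta.
  rewrite ltr_pdivlMr// => h2; apply: le_lt_trans h2.
  by rewrite mulrA mulrC ler_wpM2l// ler_wpM2l// lerDl.
have c3 : u - 2 *: damp delta u + CN_noise delta w @[delta --> 0^'+] --> u.
  by rewrite -[X in _ --> X]addr0; exact: cvgD.
apply: cvg_trans c3; apply: near_eq_cvg; near=> delta.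
have d0 : 0 < delta by near: delta; exact: nbhs_right_gt.
by rewrite CN_proposalE// CN_driftE// /damp scalerA.
Unshelve. all: by end_near. Qed.

End Resolvent.

(** * Densities *)

Section IntegralDensity.
Import HBNNSimple.

(** The density identity extends from indicators to simple functions by linearity, then to [f] by
    monotone convergence on both sides. *)
Lemma integral_density d (T : measurableType d) (R : realType)
    (mu nu : {measure set T -> \bar R}) (g : T -> R) (f : T -> \bar R) :
  measurable_fun setT g -> (forall x, 0 <= g x) ->
  (forall A, measurable A -> nu A = \int[mu]_(x in A) (g x)%:E)%E ->
  measurable_fun setT f -> (forall x, 0 <= f x)%E ->
  (\int[nu]_x f x = \int[mu]_x (f x * (g x)%:E))%E.
Proof.
move=> mg g0 nuE mf f0.
pose h := nnsfun_approx measurableT mf.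
have hf x : (h n x)%:E @[n --> \oo] --> f x.
  exact: (cvg_nnsfun_approx measurableT mf (fun x _ => f0 x)).
have ndh x a b : (a <= b)%N -> (h a x <= h b x).
  by move=> ab; exact/lefP/nd_nnsfun_approx.
have mh n : measurable_fun setT (EFin \o h n) by exact/measurable_EFinP.
have h0 n x : 0 <= h n x by [].
have cnu : (\int[nu]_x (h n x)%:E @[n --> \oo] --> \int[nu]_x f x)%E.
  under [X in _ --> X]eq_integral do rewrite -(cvg_lim _ (hf _))//.
  apply: cvg_monotone_convergence => //.
  - by move=> n x _; rewrite lee_fin.
  - by move=> x _ a b ab; rewrite lee_fin ndh.
have cmu : (\int[mu]_x ((h n x)%:E * (g x)%:E) @[n --> \oo] -->
    \int[mu]_x (f x * (g x)%:E))%E.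
  have hgf x : ((h n x)%:E * (g x)%:E @[n --> \oo] --> f x * (g x)%:E)%E.
    by apply: cvgeZr => //; exact: hf.
  under [X in _ --> X]eq_integral do rewrite -(cvg_lim _ (hgf _))//.
  apply: cvg_monotone_convergence => //.
  - by move=> n; apply: emeasurable_funM => //; exact/measurable_EFinP.
  - by move=> n x _; rewrite mule_ge0// lee_fin.
  - by move=> x _ a b ab; rewrite lee_wpmul2r ?lee_fin// ndh.
rewrite -(cvg_lim _ cnu)// -(cvg_lim _ cmu)//.
suff eh n : (\int[nu]_x (h n x)%:E = \int[mu]_x ((h n x)%:E * (g x)%:E))%E.
  by under eq_fun do rewrite eh.
under eq_integral do rewrite fimfunE -fsumEFin//.
rewrite ge0_integral_fsum//; first last.
- by move=> r x _; exact: nnfun_muleindic_ge0.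
- by move=> r; apply/measurable_EFinP; exact: measurable_funM.
under [RHS]eq_integral => x _.
  rewrite fimfunE -fsumEFin// ge0_mule_fsuml; last first.
    by move=> r; exact: nnfun_muleindic_ge0.
  over.
rewrite ge0_integral_fsum//; first last.
- by move=> r x _; rewrite mule_ge0 ?lee_fin//; exact: nnfun_muleindic_ge0.
- move=> r; apply: emeasurable_funM; last exact/measurable_EFinP.
  by apply/measurable_EFinP; exact: measurable_funM.
apply: eq_fsbigr => r /[!inE] -[x _ <-].
set r' := h n x; have mA : measurable (h n @^-1` [set r']) by [].
under eq_integral do rewrite EFinM.
rewrite ge0_integralZl ?lee_fin//; last exact/measurable_EFinP.
rewrite integral_indic// setIT nuE//.
under [RHS]eq_integral do rewrite EFinM -muleA.
rewrite ge0_integralZl ?lee_fin//; first last.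
- by move=> y _; rewrite mule_ge0// lee_fin.
- by apply: emeasurable_funM; exact/measurable_EFinP.
by rewrite integral_mkcond; congr (_ * _)%E; apply: eq_integral => y _;
  rewrite muleC epatch_indic.
Qed.

End IntegralDensity.

(** * Invariance of the Gaussian measure under reflections *)

Section GaussianReflection.
Context (R : realType) (X : normedModType R) (ip : X -> X -> R).
Hypothesis ipH : hilbert_inner ip.
Variable q : nat -> X.
Hypothesis q_dense : dense (range q).
Variables (C : X -> X) (mu0 : probability (borel X) R).
Hypothesis gauss : centred_gaussian ip C mu0.
Local Notation E h := (expR (- (ip (C h) h / 2))).

Let mip h : measurable_fun setT (ip h : borel X -> R) := measurable_ip ipH h.

Let mcos h : measurable_fun setT (fun w : borel X => cos (ip h w)).
Proof.
by apply: measurableT_comp (mip h); apply: continuous_measurable_fun;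
  exact: continuous_cos.
Qed.

Let msin h : measurable_fun setT (fun w : borel X => sin (ip h w)).
Proof.
by apply: measurableT_comp (mip h); apply: continuous_measurable_fun;
  exact: continuous_sin.
Qed.

Let cos1 (x : R) : `|cos x| <= 1. Proof. by rewrite ler_norml cos_geN1 cos_le1. Qed.
Let sin1 (x : R) : `|sin x| <= 1. Proof. by rewrite ler_norml sin_geN1 sin_le1. Qed.

(** After the addition formulas, both the inner and the outer Fubini integrals of
    [gaussian_pair_cos] and [gaussian_pair_sin] have this shape. *)
Lemma gaussian_trig a b h :
  (\int[mu0]_w (a * cos (ip h w) + b * sin (ip h w))%:E = (a * E h)%:E)%E.
Proof.
have ic : mu0.-integrable setT (EFin \o (fun w => cos (ip h w))).
  exact: (@bounded_integrable _ _ _ mu0 _ 1).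
have is_ : mu0.-integrable setT (EFin \o (fun w => sin (ip h w))).
  exact: (@bounded_integrable _ _ _ mu0 _ 1).
under eq_integral do rewrite EFinD !EFinM.
rewrite integralD//; [|exact: integrableZl..].
rewrite !integralZl//.
by have [-> ->] := gauss h; rewrite mule0 adde0.
Qed.

Lemma gaussian_pair_cos h k :
  (\int[mu0 \x mu0]_p (cos (ip h p.1 + ip k p.2))%:E = (E h * E k)%:E)%E.
Proof.
have mph : phases ip (fun p => ip h p.1 + ip k p.2) by exists h, k.
rewrite -integral12_prod_meas1; last first.
  apply: (@bounded_integrable _ _ _ (mu0 \x mu0)%E _ 1) => //.
  apply: measurableT_comp (measurable_phases ipH mph).
  by apply: continuous_measurable_fun; exact: continuous_cos.
transitivity (\int[mu0]_u (E k * cos (ip h u) + 0 * sin (ip h u))%:E)%E.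
  apply: eq_integral => u _; rewrite /fubini_F/=.
  under eq_integral => w _ do rewrite cosD -mulNr.
  by rewrite gaussian_trig mul0r addr0 mulrC.
by rewrite gaussian_trig mulrC.
Qed.

Lemma gaussian_pair_sin h k :
  (\int[mu0 \x mu0]_p (sin (ip h p.1 + ip k p.2))%:E = 0)%E.
Proof.
have mph : phases ip (fun p => ip h p.1 + ip k p.2) by exists h, k.
rewrite -integral12_prod_meas1; last first.
  apply: (@bounded_integrable _ _ _ (mu0 \x mu0)%E _ 1) => //.
  apply: measurableT_comp (measurable_phases ipH mph).
  by apply: continuous_measurable_fun; exact: continuous_sin.
transitivity (\int[mu0]_u (0 * cos (ip h u) + E k * sin (ip h u))%:E)%E.
  apply: eq_integral => u _; rewrite /fubini_F/=.
  under eq_integral => w _ do rewrite sinD.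
  by rewrite gaussian_trig mul0r add0r mulrC.
by rewrite gaussian_trig mul0r.
Qed.

Variables (A B S : X -> X).
Hypothesis linA : forall (a : R) x y, A (a *: x + y) = a *: A x + A y.
Hypothesis linB : forall (a : R) x y, B (a *: x + y) = a *: B x + B y.
Hypotheses (saA : self_adjoint ip A) (saB : self_adjoint ip B).
Hypothesis saS : self_adjoint ip S.
Hypothesis SS : forall x, S (S x) = C x.
Hypothesis linS : forall (a : R) x y, S (a *: x + y) = a *: S x + S y.
Hypothesis AS : forall x, A (S x) = S (A x).
Hypothesis BS : forall x, B (S x) = S (B x).
Hypothesis AB : forall x, A (B x) = B (A x).
Hypothesis AABB : forall x, A (A x) + B (B x) = x.

(* An involution of X x X: [A] and [B] play the roles of cosine and sine. *)
Definition reflection (p : borel X * borel X) : borel X * borel X :=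
  ((A p.1 + B p.2 : X), (B p.1 - A p.2 : X)).

(** The cross terms cancel because [A] and [B] commute. Read as a proposal, it says that the move
    made from [v] with the reflected noise returns to [u]. *)
Lemma reflection1 p : A (reflection p).1 + B (reflection p).2 = p.1.
Proof.
rewrite /= (linopD linA) (linopB linB) AB -[RHS]AABB.
by vector_ring ipH.
Qed.

Lemma measurable_drift_noise :
  measurable_fun setT (fun p : borel X * borel X => (A p.1 + B p.2 : X) : borel X).
Proof.
apply: (measurable_borel ipH q_dense) => h.
under eq_fun do rewrite (ipDr ipH) -saA -saB.
by apply: (@measurable_phases R X ip ipH); exists (A h), (B h).
Qed.

Lemma measurable_reflection : measurable_fun setT reflection.
Proof.
apply: measurable_fun_pair; first exact: measurable_drift_noise.
apply: (measurable_borel ipH q_dense) => h.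
under eq_fun do rewrite (ipBr ipH) -saA -saB -(ipNl ipH).
by apply: (@measurable_phases R X ip ipH); exists (B h), (- A h).
Qed.

(** The reflection is its own adjoint, so it can be moved from the point onto the frequencies
    [(h, k)]. *)
Lemma reflection_phase h k p :
  ip h (reflection p).1 + ip k (reflection p).2 =
  ip (A h + B k) p.1 + ip (B h - A k) p.2.
Proof.
by rewrite /= (ipDr ipH) (ipBr ipH) (ipDl ipH) (ipBl ipH) -!saA -!saB; ring.
Qed.

(** As [C = S S] and [S] commutes with [A] and [B], this says that the reflection is an isometry at
    the pair [(S h, S k)]. *)
Lemma reflection_covariance h k :
  ip (C (A h + B k)) (A h + B k) + ip (C (B h - A k)) (B h - A k) =
  ip (C h) h + ip (C k) k.
Proof.
have CE z : ip (C z) z = ip (S z) (S z) by rewrite -SS saS.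
rewrite !CE (linopD linS) (linopB linS) -!AS -!BS.
move: (S h) (S k) => {}h {}k.
rewrite -{1}[in RHS](AABB h) -{1}[in RHS](AABB k).
rewrite !(ipDl ipH, ipDr ipH, ipNl ipH, ipNr ipH).
rewrite !(saA (A _)) !(saB (B _)) (ipC ipH (B k) (A h)) (ipC ipH (A k) (B h)).
have -> : ip (A h) (B k) = ip (B h) (A k) by rewrite saA AB -saB.
by ring.
Qed.

Lemma reflection_invariant D : measurable D ->
  pushforward (mu0 \x mu0)%E reflection D = (mu0 \x mu0)%E D.
Proof.
move=> mD; have mr := measurable_reflection.
(* Bundling the reflection as a measurable function makes its pushforward a [distribution], hence a
   probability to which [pair_measure_unique] applies. *)
pose r : {mfun (borel X * borel X)%type >-> (borel X * borel X)%type} :=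
  HB.pack reflection (isMeasurableFun.Build _ _ _ _ _ mr).
have mf (f : R -> R) h k : continuous f ->
    measurable_fun setT (fun p : borel X * borel X => f (ip h p.1 + ip k p.2)).
  move=> cf; apply: measurableT_comp; first exact: continuous_measurable_fun.
  by apply: (@measurable_phases R X ip ipH); exists h, k.
have transfer (f : R -> R) h k : continuous f -> (forall x, `|f x| <= 1) ->
   (\int[distribution (mu0 \x mu0) r]_p (f (ip h p.1 + ip k p.2))%:E =
    \int[mu0 \x mu0]_p (f (ip (A h + B k) p.1 + ip (B h - A k) p.2))%:E)%E.
  move=> cf f1; rewrite integral_distribution.
  - by apply: eq_integral => p _ /=; rewrite -reflection_phase.
  - by apply/measurable_EFinP; exact: mf.
  - apply: (@bounded_integrable _ _ _ (mu0 \x mu0)%E _ 1) => //.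
    apply: measurableT_comp; first exact: continuous_measurable_fun.
    apply: (@measurable_phases R X ip ipH); exists (A h + B k), (B h - A k).
    by apply/funext => p; rewrite -reflection_phase.
have eD : distribution (mu0 \x mu0)%E r D = (mu0 \x mu0)%E D; last exact: eD.
apply: (@pair_measure_unique R X ip ipH q q_dense
  (distribution (mu0 \x mu0)%E r) (mu0 \x mu0)%E); last exact: mD.
all: move=> h k.
- rewrite transfer//; last exact: continuous_cos.
  rewrite !gaussian_pair_cos -!expRD; congr (expR _)%:E.
  rewrite -!opprD -!mulrDl; congr (- (_ / _)).
  exact: reflection_covariance.
- rewrite transfer//; last exact: continuous_sin.
  by rewrite !gaussian_pair_sin.
Qed.

End GaussianReflection.

(** * Metropolis-Hastings chains *)

Lemma integral_density_in d (T : measurableType d) (R : realType)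
    (mu nu : {measure set T -> \bar R}) (g : T -> R) (f : T -> \bar R) D :
  measurable_fun setT g -> (forall x, 0 <= g x) ->
  (forall A, measurable A -> nu A = \int[mu]_(x in A) (g x)%:E)%E ->
  measurable D -> measurable_fun setT f -> (forall x, 0 <= f x)%E ->
  (\int[nu]_(x in D) f x = \int[mu]_(x in D) (f x * (g x)%:E))%E.
Proof.
move=> mg g0 nuE mD mf f0.
rewrite integral_mkcond (integral_density mg g0 nuE); first last.
- by move=> x; rewrite patchE; case: ifP.
- by apply/(measurable_restrictT f mD); exact: measurable_funTS.
rewrite [RHS]integral_mkcond; apply: eq_integral => x _.
by rewrite !patchE; case: ifP => //; rewrite mul0e.
Qed.

Lemma product_density d1 d2 (T1 : measurableType d1) (T2 : measurableType d2)
    (R : realType) (m1 n1 : probability T1 R) (m2 : probability T2 R)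
    (g : T1 -> R) A :
  measurable_fun setT g -> (forall x, 0 <= g x) ->
  (forall A, measurable A -> n1 A = \int[m1]_(x in A) (g x)%:E)%E ->
  measurable A ->
  ((n1 \x m2) A = \int[m1 \x m2]_(p in A) (g p.1)%:E)%E.
Proof.
move=> mg g0 nE mA.
have mg1 : measurable_fun setT (fun p : T1 * T2 => g p.1).
  exact: measurableT_comp mg measurable_fst.
have -> : ((n1 \x m2) A = \int[n1]_x m2 (xsection A x))%E by [].
rewrite (integral_density mg g0 nE) //; last exact: measurable_fun_xsection.
rewrite [RHS]integral_mkcond fubini_tonelli1//; first last.
- by move=> p; rewrite patchE; case: ifP => //; rewrite lee_fin.
- apply/(measurable_restrictT _ mA); apply: measurable_funTS.
  exact/measurable_EFinP.
apply: eq_integral => x _; rewrite /fubini_F.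
transitivity (\int[m2]_y ((g x)%:E * (\1_(xsection A x) y)%:E))%E; last first.
  apply: eq_integral => y _; rewrite patchE indicE mem_xsection.
  by case: ifP => _; rewrite ?mule1 ?mule0.
rewrite ge0_integralZl ?lee_fin//; last first.
  apply/measurable_EFinP; apply: measurable_indic.
  exact: measurable_xsection.
rewrite integral_indic//; last exact: measurable_xsection.
by rewrite setIT muleC.
Qed.

Lemma cvg_at_right_seq (R : realType) (u : R ^nat) :
  (forall n, 0 < u n) -> u n @[n --> \oo] --> 0 -> u n @[n --> \oo] --> 0^'+.
Proof.
move=> u0 ucvg P; rewrite /at_right /within/= => /ucvg[N _ hN].
by exists N => // n Nn; exact: hN Nn (u0 n).
Qed.

Lemma local_lipschitz_continuous (R : realType) (X : normedModType R)
    (Phi : X -> R) :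
  (forall r : R, 0 < r -> exists Kr : R, 0 < Kr /\
     forall u v : X, Num.max `|u| `|v| < r -> `|Phi u - Phi v| <= Kr * `|u - v|) ->
  continuous Phi.
Proof.
(* With this radius the Lipschitz bound covers [u] and every [v] at distance less than 1 from it. *)
move=> lip u; have r0 : 0 < `|u| + 1 by rewrite ltr_wpDl.
have [K [K0 hK]] := lip _ r0.
apply/(@cvgrPdist_lt _ R^o) => /= e e0.
near=> v.
have uv1 : `|u - v| < 1.
  by near: v; apply: (@cvgr_dist_lt _ _ _ _ (nbhs_filter u) id u cvg_id).
have uve : `|u - v| < e / K.
  by near: v; apply: (@cvgr_dist_lt _ _ _ _ (nbhs_filter u) id u cvg_id);
    exact: divr_gt0.
apply: le_lt_trans (hK u v _) _; last by rewrite mulrC -ltr_pdivlMr.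
rewrite gt_max ltrDl ltr01/=.
have -> : v = u - (u - v) by rewrite subKr.
by apply: le_lt_trans (ler_normB _ _) _; rewrite ltrD2l.
Unshelve. all: by end_near. Qed.

Section Metropolis.
Context (R : realType) (X : normedModType R) (ip : X -> X -> R).
Hypothesis ipH : hilbert_inner ip.
Variable q : nat -> X.
Hypothesis q_dense : dense (range q).
Variables (mu0 mu : probability (borel X) R) (Phi : X -> R).
Hypothesis cPhi : continuous Phi.

Let mPhi : measurable_fun setT (Phi : borel X -> R) :=
  continuous_measurable_borel cPhi.

Let mexp (f : borel X * borel X -> R) : measurable_fun setT f ->
  measurable_fun setT (fun p => expR (f p)).
Proof. by move=> mf; apply: measurableT_comp mf; exact: measurable_expR. Qed.

(** The limit is tested along sequences and pulled back to [mu \x mu0], which is independent of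
    [delta]; dominated convergence then applies with the constant bound 1. *)
Lemma mean_acceptance_cvg (prop : R -> X -> X -> X) :
  (forall delta, 0 < delta -> measurable_fun setT
     (fun p : borel X * borel X => prop delta p.1 p.2 : borel X)) ->
  (forall u w, prop delta u w @[delta --> 0^'+] --> u) ->
  mean_acceptance mu mu0 (prop delta) Phi @[delta --> 0^'+] --> 1%E.
Proof.
move=> mprop pcvg; apply/cvge_at_rightP => e [e0 ecvg].
pose F n (p : borel X * borel X) : R :=
  Num.min 1 (expR (Phi p.1 - Phi (prop (e n) p.1 p.2))).
have mPhi1 : measurable_fun setT (fun p : borel X * borel X => Phi p.1).
  exact: measurableT_comp mPhi measurable_fst.
have mPhi2 : measurable_fun setT (fun p : borel X * borel X => Phi p.2).
  exact: measurableT_comp mPhi measurable_snd.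
have mF n : measurable_fun setT (F n).
  apply: measurable_minr; first exact: measurable_cst.
  apply: mexp; apply: measurable_funB => //.
  exact: measurableT_comp mPhi (mprop _ (e0 n)).
have accE n : (mean_acceptance mu mu0 (prop (e n)) Phi =
    \int[mu \x mu0]_p (F n p)%:E)%E.
  rewrite /mean_acceptance /eta_law ge0_integral_pushforward//.
  - by apply: measurable_fun_pair; [exact: measurable_fst|exact: mprop].
  - apply/measurable_EFinP; apply: measurable_minr; first exact: measurable_cst.
    by apply: mexp; apply: measurable_funB.
under eq_fun do rewrite accE.
have -> : 1%E = (\int[mu \x mu0]_p (cst (1 : R) p)%:E)%E.
  have -> : (fun p : borel X * borel X => (cst (1 : R) p)%:E) = cst 1%:E by [].
  by rewrite integral_cst// mul1e; exact/esym/(probability_setT (mu \x mu0)%E).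
apply: (@bounded_cvg_integral _ _ _ (mu \x mu0)%E F (cst 1) 1) => // [n p|p].
  rewrite ger0_norm /F ?ge_min ?lexx// le_min ler01; exact: expR_ge0.
have c1 : Phi (prop (e n) p.1 p.2) @[n --> \oo] --> Phi p.1.
  apply: (@cvg_comp _ _ _ (fun n => prop (e n) p.1 p.2) Phi _ (nbhs (p.1 : X)));
    last exact: cPhi.
  apply: (@cvg_comp _ _ _ e (fun d => prop d p.1 p.2) _ 0^'+); last exact: pcvg.
  exact: cvg_at_right_seq.
have c2 : expR (Phi p.1 - Phi (prop (e n) p.1 p.2)) @[n --> \oo] --> (1 : R).
  rewrite -expR0 -(subrr (Phi p.1)).
  apply: (@cvg_comp _ _ _ _ expR _ (nbhs (Phi p.1 - Phi p.1)));
    last exact: continuous_expR.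
  by apply: cvgB => //; exact: cvg_cst.
move/cvgrPdist_lt : c2 => c2; apply/cvgrPdist_lt => eps eps0.
apply: filterS (c2 _ eps0) => n; apply: le_lt_trans; rewrite /F /cst.
(* Truncation at 1 never increases the distance to 1. *)
set y := expR _; have [_|_] := leP 1 y => //.
by rewrite subrr normr0.
Qed.

Variables (C A B S : X -> X) (Z : R).
Hypothesis gauss : centred_gaussian ip C mu0.
Hypothesis Z0 : 0 < Z.
Hypothesis muE : forall D : set (borel X), measurable D ->
  (mu D = (Z^-1)%:E * \int[mu0]_(x in D) (expR (- Phi x))%:E)%E.
Hypothesis linA : forall (a : R) x y, A (a *: x + y) = a *: A x + A y.
Hypothesis linB : forall (a : R) x y, B (a *: x + y) = a *: B x + B y.
Hypotheses (saA : self_adjoint ip A) (saB : self_adjoint ip B).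
Hypothesis saS : self_adjoint ip S.
Hypothesis SS : forall x, S (S x) = C x.
Hypothesis linS : forall (a : R) x y, S (a *: x + y) = a *: S x + S y.
Hypothesis AS : forall x, A (S x) = S (A x).
Hypothesis BS : forall x, B (S x) = S (B x).
Hypothesis AB : forall x, A (B x) = B (A x).
Hypothesis AABB : forall x, A (A x) + B (B x) = x.
Variable prop : X -> X -> X.
Hypothesis propE : forall u w, prop u w = A u + B w.

Let g (u : borel X) : R := Z^-1 * expR (- Phi u).

Let g_gt0 u : 0 < g u.
Proof. by rewrite mulr_gt0 ?invr_gt0 ?expR_gt0. Qed.

Let g_ge0 u : 0 <= g u. Proof. exact: ltW. Qed.

Let mg : measurable_fun setT g.
Proof.
apply: measurable_funM => //; apply: measurableT_comp; first exact: measurable_expR.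
exact: measurableT_comp.
Qed.

Let mu_density D : measurable D -> (mu D = \int[mu0]_(x in D) (g x)%:E)%E.
Proof.
move=> mD; rewrite muE// -ge0_integralZl//.
- apply/measurable_EFinP; apply: measurable_funTS.
  apply: measurableT_comp; first exact: measurable_expR.
  exact: measurableT_comp.
- by rewrite lee_fin invr_ge0 ltW.
Qed.

Local Notation rho := (reflection A B).

Let mrho : measurable_fun setT rho.
Proof. exact: (measurable_reflection ipH q_dense). Qed.

Let step (p : borel X * borel X) : borel X * borel X := (p.1, prop p.1 p.2).

Let stepE p : step p = (p.1, (rho p).1).
Proof. by rewrite /step propE. Qed.

Let mstep : measurable_fun setT step.
Proof.
have -> : step = (fun p => (p.1, (rho p).1)) by apply/funext => p; exact: stepE.
apply: measurable_fun_pair; first exact: measurable_fst.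
exact: measurableT_comp measurable_fst mrho.
Qed.

Lemma MH_defined_reflection : MH_defined mu mu0 prop Phi.
Proof.
have mg1 : measurable_fun setT (fun p : borel X * borel X => g p.1).
  exact: measurableT_comp mg measurable_fst.
have mg2 : measurable_fun setT (fun p : borel X * borel X => g (rho p).1).
  exact: measurableT_comp mg1 mrho.
have pd := @product_density _ _ _ _ _ mu0 mu mu0 g _ mg g_ge0 mu_density.
(* Reflecting the input [(u, w)] swaps the output [(u, v)]: this is the exchangeability behind the
   density. *)
have step_rho p : step (rho p) = (prop p.1 p.2, p.1).
  by rewrite /step propE (reflection1 ipH linA linB AB AABB) propE.
have perpE D : measurable D -> eta_perp mu mu0 prop D =
    (\int[mu0 \x mu0]_(p in step @^-1` D) (g (rho p).1)%:E)%E.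
  move=> mD; have mK : measurable (step @^-1` D) by rewrite -[X in measurable X]setTI; exact: mstep.
  transitivity ((mu \x mu0)%E (rho @^-1` (step @^-1` D))).
    rewrite /eta_perp /eta_law /pushforward; congr ((_ \x _)%E _).
    by apply/funext => p; rewrite /preimage/= step_rho.
  rewrite pd; last by rewrite -[X in measurable X]setTI; exact: mrho.
  (* By [reflection1], [p.1] is the first component of [rho (rho p)]; the integral is therefore one
     against the pushforward by [rho], which invariance identifies with [mu0 \x mu0]. *)
  transitivity (\int[pushforward (mu0 \x mu0)%E rho]_(p in step @^-1` D)
      (g (rho p).1)%:E)%E.
    rewrite (ge0_integral_pushforward mrho _ mK).
    - apply: eq_integral => p _ /=; congr (g _)%:E.
      exact: (esym (reflection1 ipH linA linB AB AABB p)).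
    - by apply: measurable_funTS; exact/measurable_EFinP.
    - by move=> p _; rewrite lee_fin.
  apply: eq_measure_integral => E mE _.
  exact: (reflection_invariant ipH q_dense gauss saA saB saS SS linS AS BS AB AABB).
have etaE D : measurable D -> eta_law mu mu0 prop D =
    (\int[mu0 \x mu0]_(p in step @^-1` D) (g p.1)%:E)%E.
  move=> mD; rewrite /eta_law /pushforward pd//.
  by rewrite -[X in measurable X]setTI; exact: mstep.
have mratio : measurable_fun setT
    (fun z : borel X * borel X => (expR (Phi z.1 - Phi z.2))%:E).
  apply/measurable_EFinP; apply: mexp; apply: measurable_funB.
    exact: measurableT_comp mPhi measurable_fst.
  exact: measurableT_comp mPhi measurable_snd.
split=> D mD; have mK : measurable (step @^-1` D)
    by rewrite -[X in measurable X]setTI; exact: mstep.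
  rewrite (perpE _ mD) /eta_law -/step.
  rewrite (ge0_integral_pushforward mstep _ mD); first last.
  - by move=> z _; rewrite lee_fin expR_ge0.
  - exact: measurable_funTS mratio.
  rewrite [RHS](integral_density_in (mu := (mu0 \x mu0)%E)
    (nu := (mu \x mu0)%E) mg1 (fun p => g_ge0 p.1) pd mK); first last.
  - by move=> p; rewrite lee_fin expR_ge0.
  - exact: measurableT_comp mratio mstep.
  apply: eq_integral => p _; rewrite /comp stepE -EFinM.
  (* Pointwise, [expR (Phi u - Phi v) * g u = g v]. *)
  by congr EFin; rewrite /g mulrCA -expRD; congr (_ * expR _); ring.
rewrite (perpE _ mD) (etaE _ mD) => int0.
(* Since [g] is strictly positive, a zero integral forces its domain to be null for [mu0 \x mu0],
   and the law [eta] has a density with respect to that measure. *)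
have : (mu0 \x mu0)%E (step @^-1` D) = 0%E.
  have mg2K : measurable_fun (step @^-1` D) (fun p => (g (rho p).1)%:E).
    by apply: measurable_funTS; exact/measurable_EFinP.
  have := (ae_eq_integral_abs (mu0 \x mu0)%E mK mg2K).1.
  under eq_integral do rewrite gee0_abs ?lee_fin//.
  move=> /(_ int0)[N [mN N0 KN]]; apply/eqP; rewrite -measure_le0 -N0.
  rewrite le_measure ?inE// => p Kp; apply: KN => /= /(_ Kp)/eqP.
  by rewrite eqe gt_eqF.
by move=> K0; rewrite null_set_integral//; exact/measurable_funTS/measurable_EFinP.
Qed.

End Metropolis.

Lemma pCN_drift_noise (R : realType) (delta : R) : 0 < delta ->
  ((2 - delta) / (2 + delta)) ^+ 2 +
  (Num.sqrt (8 * delta) / (2 + delta)) ^+ 2 = 1.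
Proof.
move=> d0; rewrite !exprMn sqr_sqrtr; last by rewrite mulr_ge0// ltW.
(* The identity is [(2 - delta)^2 + 8 delta = (2 + delta)^2], the scalar analogue of [CN_square]. *)
by field; rewrite gt_eqF// addr_gt0.
Qed.

Lemma pCN_cvg (R : realType) (X : normedModType R) (u w : X) :
  pCN_proposal delta u w @[delta --> 0^'+] --> u.
Proof.
have dcvg : delta @[delta --> 0^'+] --> (0 : R).
  by apply: cvg_at_right_filter; exact: cvg_id.
have c2 : (2 + delta)^-1 @[delta --> 0^'+] --> (2^-1 : R).
  apply: cvgV => //; rewrite -[X in _ --> X]addr0.
  by apply: cvgD => //; exact: cvg_cst.
have lim_u : ((2 - 0) / 2 : R) *: u + (Num.sqrt (8 * 0) / 2) *: w = u.
  by rewrite mulr0 sqrtr0 mul0r scale0r addr0 subr0 divff// scale1r.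
rewrite /pCN_proposal -[X in _ --> X]lim_u.
apply: cvgD; apply: cvgZ; try exact: cvg_cst.
  by apply: cvgM => //; apply: cvgB => //; exact: cvg_cst.
apply: cvgM => //.
apply: (@cvg_comp _ _ _ _ Num.sqrt _ (nbhs (8 * 0 : R))).
  by apply: cvgMr.
exact: sqrt_continuous.
Qed.

Theorem theorem7p3 (R : realType) (X : completeNormedModType R)
  (ip : X -> X -> R) (C S : X -> X)
  (mu0 mu : probability (borel X) R) (Phi : X -> R) :
  separable_hilbert ip ->
  bounded_linear C -> self_adjoint ip C -> positive_definite ip C ->
  trace_class ip C ->
  (* S is the (positive) square root C^{1/2} of C *)
  bounded_linear S -> self_adjoint ip S -> nonnegative_op ip S ->
  (forall x, S (S x) = C x) ->
  centred_gaussian ip C mu0 ->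
  (exists (p K : R), 0 < p /\ 0 < K /\
     forall u : X, 0 <= Phi u /\ Phi u <= K * (1 + powR `|u| p)) ->
  (forall r : R, 0 < r -> exists Kr : R, 0 < Kr /\
     forall u v : X, Num.max `|u| `|v| < r -> `|Phi u - Phi v| <= Kr * `|u - v|) ->
  (exists Z : R, 0 < Z /\ forall A : set (borel X), measurable A ->
     (mu A = (Z^-1)%:E * \int[mu0]_(x in A) (expR (- Phi x))%:E)%E) ->
  (* pCN *)
  ((forall delta : R, 0 < delta -> MH_defined mu mu0 (pCN_proposal delta) Phi) /\
   (fun delta => mean_acceptance mu mu0 (pCN_proposal delta) Phi)
     @ 0^'+ --> 1%E) /\
  (* CN *)
  ((forall delta : R, 0 < delta -> MH_defined mu mu0 (CN_proposal C S delta) Phi) /\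
   (fun delta => mean_acceptance mu mu0 (CN_proposal C S delta) Phi)
     @ 0^'+ --> 1%E).
Proof.
move=> [ipH [q q_dense]] bC saC pdC _ bS saS _ SS gauss _ lipPhi [Z [Z0 muE]].
have cPhi := local_lipschitz_continuous lipPhi.
have saZ a : self_adjoint ip (fun x => a *: x).
  by move=> x y; rewrite (ipZl ipH) (ipZr ipH).
have linS := bS.1.
split; split.
- move=> delta d0.
  (* For pCN, [A] and [B] are multiples of the identity, so every commutation condition is
     immediate. *)
  apply: (@MH_defined_reflection R X ip ipH q q_dense mu0 mu Phi cPhi C
    (fun x => ((2 - delta) / (2 + delta)) *: x)
    (fun x => (Num.sqrt (8 * delta) / (2 + delta)) *: x) S Z) => //.
  + by move=> a x y; vector_ring ipH.
  + by move=> a x y; vector_ring ipH.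
  + by move=> x; rewrite (linopZ linS).
  + by move=> x; rewrite (linopZ linS).
  + by move=> x; rewrite !scalerA mulrC.
  + by move=> x; rewrite !scalerA -scalerDl -!expr2 pCN_drift_noise// scale1r.
- apply: mean_acceptance_cvg => //; last exact: pCN_cvg.
  by move=> delta d0; exact: (measurable_drift_noise ipH q_dense (saZ _) (saZ _)).
- move=> delta d0.
  apply: (@MH_defined_reflection R X ip ipH q q_dense mu0 mu Phi cPhi C
    (CN_drift C delta) (CN_noise C S delta) S Z) => //.
  + exact: CN_drift_linear ipH bC pdC _ d0.
  + exact: CN_noise_linear ipH bC pdC bS SS _ d0.
  + exact: CN_drift_sa ipH bC saC pdC _ d0.
  + exact: CN_noise_sa ipH bC saC pdC bS saS SS _ d0.
  + exact: CN_drift_S ipH bC pdC bS SS _ d0.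
  + exact: CN_noise_S ipH bC pdC bS SS _ d0.
  + exact: CN_drift_noise ipH bC pdC bS SS _ d0.
  + exact: CN_square ipH bC pdC bS SS _ d0.
  + by move=> u w; exact: (CN_proposalE S ipH bC pdC _ _ d0).
- apply: mean_acceptance_cvg => //; last exact: (CN_cvg ipH bC pdC bS saS SS).
  move=> delta d0.
  have -> : (fun p : borel X * borel X => CN_proposal C S delta p.1 p.2) =
      (fun p => CN_drift C delta p.1 + CN_noise C S delta p.2).
    by apply/funext => p; exact: (CN_proposalE S ipH bC pdC _ _ d0).
  apply: (measurable_drift_noise ipH q_dense).
    exact: (CN_drift_sa ipH bC saC pdC d0).
  exact: (CN_noise_sa ipH bC saC pdC bS saS SS d0).
Qed.
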